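(* Let $u\ge 1$ and $\theta\in(0,1)$ be such that $(1-\theta)u<1$. Let $\mathcal A$ be a finite non-empty set of positive integers, $x:=\sup\mathcal A$, and let $y>1$ be defined by $u=\frac{\log x}{\log y}$. Let $X,\kappa$ be positive real numbers and $\gamma$ a multiplicative arithmetic function. For $d\ge1$ put $A_d:=\#\{n\in\mathcal A: d\mid n\}$ and $r_d:=A_d-\frac{\gamma(d)}{d}X$. Assume the following three conditions (where $p$ runs over primes): (1) there is $A\ge0$ such that for all $z\ge2$, $\left|\sum_{p\le z}\frac{\log p}{p}\gamma(p)-\kappa\log z\right|\le A$; (2) there is $B\ge0$ such that $\gamma(p^\alpha)\le B$ for all primes $p$ and all integers $\alpha\ge1$; (3) there is $\delta>0$ such that $\sum_{d\le y^{u\theta}}|r_d|\ll \frac{X}{(\log y)^\delta}$. Then $$\#\{n\in\mathcal A: P^+(n)\le y\}\ \ge\ \{\varrho_{\theta,\kappa}(u)+o(1)\}\,\#\mathcal A$$ as $x\to\infty$, where the coefficient $\varrho_{\theta,\kappa}(u)$ (defined in the context) is $>0$. The convergence is uniform for $u$ bounded. Moreover $\varrho_{\theta,1}(u)\to\varrho(u)$ (Dickman's function) as $\theta\to1$.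
   Context: $P^+(n)$ denotes the largest prime factor of $n\ge1$, with $P^+(1):=1$. The statement is asymptotic: $\mathcal A$ (hence $x,y$), and possibly $X$ and $\gamma$, vary with $x\to\infty$, while $\theta,\kappa$ and the constants $A,B,\delta$ and the implied constant in (3) are fixed. Dickman's function $\varrho$ is the unique function on $[0,\infty)$ that is continuous, differentiable on $(1,\infty)$, equal to $1$ on $[0,1]$, and satisfies $u\varrho'(u)+\varrho(u-1)=0$ for $u>1$. Definition of $\varrho_{\theta,\kappa}$. For $k\ge1$ put $f_k(u;t_1,\dots,t_k):=\prod_{i=1}^k\frac{1}{u-t_1-\cdots-t_i}$. For $k\ge2$, $u>0$ and $0\le v\le\min(1,u)$ let $$V_k(u,v):=\{\boldsymbol t\in(0,1)^k:\ t_1+\cdots+t_{k-1}<u-1<t_1+\cdots+t_k<u-v\},$$ $$\mu_k(u,v):=\frac1u\int_{V_k(u,v)}f_{k-1}(u;t_1,\dots,t_{k-1})\,\mathrm d\boldsymbol t,$$ and $\mu_1(u,v):=\frac1u\,\mathrm{mes}\big((0,1)\cap(u-1,u-v)\big)$ (Lebesgue measure). Put $\mu^{(\kappa)}(u,v):=\sum_{k\ge1}\kappa^k\mu_k(u,v)$ (a convergent series) and $$\varrho_{\theta,\kappa}(u):=\mu^{(\kappa)}(u,(1-\theta)u).$$ *)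

(* Defs.v *)
From HB Require Import structures.
From mathcomp Require Import all_boot all_order all_algebra finmap.
From mathcomp Require Import all_classical all_reals all_analysis.

Set Implicit Arguments.
Unset Strict Implicit.
Unset Printing Implicit Defensive.

Import Order.TTheory GRing.Theory Num.Theory.
Import numFieldNormedType.Exports.

Local Open Scope classical_set_scope.
Local Open Scope ring_scope.

Section tuple_cons_measure.
Context (R : realType) (n : nat).
Variable m : {sigma_finite_measure set (n.-tuple (measurableTypeR R)) -> \bar R}.

Definition cons_pair (p : measurableTypeR R * n.-tuple (measurableTypeR R)) :
  n.+1.-tuple (measurableTypeR R) := [tuple of p.1 :: p.2].

Lemma measurable_cons_pair : measurable_fun setT cons_pair.
Proof. exact: measurable_cons. Qed.

Definition tuple_cons_measure : set (n.+1.-tuple (measurableTypeR R)) -> \bar R :=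
  pushforward (@lebesgue_measure R \x m)%E cons_pair.

Let tuple_cons_measure0 : tuple_cons_measure set0 = 0%E.
Proof. by rewrite /tuple_cons_measure /pushforward preimage_set0 measure0. Qed.

Let tuple_cons_measure_ge0 A : (0 <= tuple_cons_measure A)%E.
Proof. exact: (measure_ge0 (@lebesgue_measure R \x m)%E). Qed.

Let tuple_cons_measure_sigma_additive :
  semi_sigma_additive tuple_cons_measure.
Proof.
move=> F mF tF mUF; rewrite /tuple_cons_measure /pushforward preimage_bigcup.
apply: measure_semi_sigma_additive.
- by move=> k; rewrite -[X in measurable X]setTI; exact: measurable_cons_pair.
- apply/trivIsetP => /= i j _ _ ij; rewrite -preimage_setI.
  by move/trivIsetP : tF => /(_ _ _ _ _ ij) ->//; rewrite preimage_set0.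
- rewrite -preimage_bigcup -[X in measurable X]setTI.
  exact: measurable_cons_pair.
Qed.

HB.instance Definition _ := isMeasure.Build _ _ _ tuple_cons_measure
  tuple_cons_measure0 tuple_cons_measure_ge0 tuple_cons_measure_sigma_additive.

Let tuple_cons_measure_sigma_finite : sigma_finite setT tuple_cons_measure.
Proof.
have [F TF F_fin] : exists2 F : (set _)^nat, setT = \bigcup_i F i &
    forall i, measurable (F i) /\ ((@lebesgue_measure R \x m) (F i) < +oo)%E.
  have /sigma_finiteP[F [TF ndF Foo]] := sigma_finiteT (@lebesgue_measure R).
  have /sigma_finiteP[G [TG ndG Goo]] := sigma_finiteT m.
  exists (fun i => F i `*` G i).
    rewrite -setXTT TF TG predeqE => -[a t]; split.
      move=> [/= [i _ Fia] [k _ Gkt]]; exists (maxn i k) => //; split.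
      - by move: a Fia; exact/subsetPset/ndF/leq_maxl.
      - by move: t Gkt; exact/subsetPset/ndG/leq_maxr.
    by move=> [i _ []/= ? ?]; split; exists i.
  move=> i; have [? ?] := Foo i; have [? ?] := Goo i.
  split; first exact: measurableX.
  by rewrite product_measure1E// lte_mul_pinfty// ge0_fin_numE.
pose uncons (t : n.+1.-tuple (measurableTypeR R)) :
  measurableTypeR R * n.-tuple (measurableTypeR R) :=
  (thead t, [tuple of behead t]).
have cpK : cancel cons_pair uncons.
  by case=> a t; congr pair; apply/val_inj.
have mu : measurable_fun setT uncons.
  apply/measurable_fun_pairP; split => //=; first exact: measurable_tnth.
  exact: measurable_behead.
exists (fun i => uncons @^-1` F i).
  by rewrite -preimage_bigcup -TF preimage_setT.
move=> i; have [mF Foo] := F_fin i; split.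
  by rewrite -[X in measurable X]setTI; exact: mu.
rewrite /tuple_cons_measure /pushforward -comp_preimage.
by rewrite (_ : uncons \o cons_pair = id) //; apply/funext => p /=.
Qed.

HB.instance Definition _ := Measure_isSigmaFinite.Build _ _ _
  tuple_cons_measure tuple_cons_measure_sigma_finite.

End tuple_cons_measure.

(* Lebesgue measure on R^n, as the n-fold product of Lebesgue measure on R. *)
Fixpoint lebesgue_tuple (R : realType) (n : nat) :
    {sigma_finite_measure set (n.-tuple (measurableTypeR R)) -> \bar R} :=
  match n with
  | 0 => \d_([tuple] : 0.-tuple (measurableTypeR R))
  | n'.+1 => tuple_cons_measure (lebesgue_tuple R n')
  end.

Lemma lebesgue_tuple_box (R : realType) (n : nat)
    (A : 'I_n -> set (measurableTypeR R)) :
  (forall i, measurable (A i)) ->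
  lebesgue_tuple R n [set t | forall i, A i (tnth t i)] =
  (\prod_(i < n) lebesgue_measure (A i))%E.
Proof.
elim: n A => [|n IHn] A mA.
  by rewrite big_ord0 /= diracE mem_set // => -[].
rewrite big_ord_recl -IHn => [|i]; last exact: mA.
rewrite /= /tuple_cons_measure /pushforward.
rewrite (_ : _ @^-1` _ = A ord0 `*` [set t | forall i, A (lift ord0 i) (tnth t i)]).
  apply: product_measure1E => //.
  rewrite (_ : mkset _ = \bigcap_(i in [set: 'I_n])
      ((@tnth n (measurableTypeR R))^~ i @^-1` A (lift ord0 i))).
    apply: fin_bigcap_measurable => // i _.
    by rewrite -[X in measurable X]setTI; exact: measurable_tnth.
  by apply/seteqP; split => [t At i _|t At i]; [exact: At|exact: (At i)].
apply/seteqP; split => [[a t] /= At|[a t] /= [Aa At] i].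
  by split => [|i]; [exact: (At ord0)|have := At (lift ord0 i); rewrite tnthS].
by have [j ->|->] := unliftP ord0 i; [rewrite tnthS|].
Qed.

Section rho_theta_kappa.
Variable R : realType.

(* t_1 + ... + t_j, where t_i is stored at index i - 1. *)
Definition psum n (t : n.-tuple R) (j : nat) : R :=
  \sum_(i < n | (i < j)%N) tnth t i.

(* f_k(u; t_1, ..., t_k), reading only the first k coordinates of t. *)
Definition fk (k : nat) (u : R) n (t : n.-tuple R) : R :=
  \prod_(1 <= i < k.+1) (u - psum t i)^-1.

Definition Vk (k : nat) (u v : R) : set (k.-tuple (measurableTypeR R)) :=
  [set t | (forall i : 'I_k, 0 < tnth t i < 1) /\
           psum t k.-1 < u - 1 /\ u - 1 < psum t k /\ psum t k < u - v].

(* The value at k = 0 is irrelevant. *)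
Definition muk (k : nat) (u v : R) : R :=
  if k == 1%N then
    u^-1 * fine (lebesgue_measure
                   (`]0, 1[%classic `&` `]u - 1, u - v[%classic : set R))
  else
    u^-1 * \int[lebesgue_tuple R k]_(t in @Vk k u v) fk k.-1 u t.

Definition mu_kappa (kappa u v : R) : R :=
  limn (fun n : nat => \sum_(1 <= k < n) (kappa ^+ k * muk k u v)).

Definition rho_tk (theta kappa u : R) : R :=
  mu_kappa kappa u ((1 - theta) * u).

(* Characterizes Dickman's function on [0, +oo[; values on ]-oo, 0[ are free. *)
Definition is_dickman (rho : R -> R) : Prop :=
  [/\ {within `[0, +oo[%classic, continuous rho},
      (forall u, 1 < u -> derivable rho u 1),
      (forall u, 0 <= u <= 1 -> rho u = 1) &
      (forall u, 1 < u -> u * (rho^`())%classic u + rho (u - 1) = 0)].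

End rho_theta_kappa.

Section sieve.
Variable R : realType.

Definition multiplicative_arith (g : nat -> R) : Prop :=
  g 1%N = 1 /\
  forall m n : nat, (0 < m)%N -> (0 < n)%N -> coprime m n ->
    g (m * n)%N = g m * g n.

Definition multiples (S : {fset nat}) (d : nat) : {fset nat} :=
  [fset n in S | (d %| n)%N]%fset.

Definition remainder (S : {fset nat}) (X : R) (g : nat -> R) (d : nat) : R :=
  #|` multiples S d|%:R - g d / d%:R * X.

(* The library's max_pdiv is the largest prime factor, with max_pdiv 1 = 1. *)
Definition friables (S : {fset nat}) (y : R) : {fset nat} :=
  [fset n in S | (max_pdiv n)%:R <= y]%fset.

End sieve.

(* Main.v *)
Require Import Defs.
From HB Require Import structures.
From mathcomp Require Import all_boot all_order all_algebra finmap.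
From mathcomp Require Import all_classical all_reals all_analysis.
From mathcomp Require Import measurable_realfun ring lra.

Set Implicit Arguments.
Unset Strict Implicit.
Unset Printing Implicit Defensive.

Import Order.TTheory GRing.Theory Num.Theory.
Import numFieldNormedType.Exports.

Local Open Scope classical_set_scope.
Local Open Scope ring_scope.

(** Remove prime factors p_1, p_2, ... from n one after the other, choosing p_i
    with probability log p_i / log (n / (p_1 ... p_(i-1))) among the primes
    dividing the remaining cofactor, and stop as soon as x / (p_1 ... p_k) < y.
    If all the p_i are at most y then n is friable, so the number of friable n
    in A is at least the sum, over the p_1, ..., p_k stopping at this stage with
    p_1 ... p_k <= x^theta, of A_(p_1 ... p_k) times the corresponding weight,
    where log n is replaced by log x in the denominators. The total weight
    attached to a given d = p_1 ... p_k is at most 1, so condition (3) controls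
    the remainders, and (1) identifies the main term with the sum of the
    kappa^k mu_k(u, v), v = (1 - theta) u. Splitting off the first prime removed
    gives, with v fixed, the equation
      u mu(u, v) = kappa |(0, 1) `&` (u - 1, u - v)|
                   + kappa \int_0^(min (1, u - 1)) mu(u - t, v) dt
    from which the uniform convergence of the series, the positivity and the
    comparison with Dickman's function (the case kappa = 1, v = 0) all follow
    by iteration. *)

(** * Integrals over segments and Lipschitz functions *)

Section segment_integral.
Variable R : realType.
Notation mu := (@lebesgue_measure R).
Implicit Types (f g : R -> R) (a b c L M : R).

Lemma continuous_integrable_itvcc f a b : continuous f ->
  mu.-integrable `[a, b] (EFin \o f).
Proof.
move=> cf; apply: continuous_compact_integrable; first exact: segment_compact.
exact: continuous_subspaceT.
Qed.

Lemma Rintegral_itvcc_cst a b M : a <= b ->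
  \int[mu]_(x in `[a, b]) M = M * (b - a).
Proof.
move=> ab; rewrite Rintegral_cst//= lebesgue_measure_itv/= lte_fin.
case: ltP => //= ba; have -> : b = a by apply/le_anti; rewrite ab ba.
by rewrite subrr.
Qed.

Lemma Rintegral_itvcc_cat f a b c : continuous f -> a <= c -> c <= b ->
  \int[mu]_(x in `[a, b]) f x =
  \int[mu]_(x in `[a, c]) f x + \int[mu]_(x in `[c, b]) f x.
Proof.
move=> cf ac cb.
have := @Rintegral_itvB R f (BLeft a) (BRight b) c
  (continuous_integrable_itvcc _ _ cf).
rewrite !bnd_simp => /(_ ac cb) H.
rewrite -(Rintegral_itv_obnd_cbnd (r := c)); last first.
  apply: integrableS (@continuous_integrable_itvcc f c b cf) => //.
  exact: subset_itv_oc_cc.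
by rewrite -H addrC subrK.
Qed.

Lemma le_Rintegral_itvcc f g a b : continuous f -> continuous g ->
  (forall x, a <= x <= b -> f x <= g x) ->
  \int[mu]_(x in `[a, b]) f x <= \int[mu]_(x in `[a, b]) g x.
Proof.
move=> cf cg fg; by apply: le_Rintegral => //;
  exact: continuous_integrable_itvcc.
Qed.

Lemma Rintegral_itvcc_le f a b M : continuous f -> a <= b ->
  (forall x, a <= x <= b -> f x <= M) ->
  \int[mu]_(x in `[a, b]) f x <= M * (b - a).
Proof.
move=> cf ab fM; rewrite -Rintegral_itvcc_cst//.
by apply: le_Rintegral_itvcc => // x; exact: cst_continuous.
Qed.

Lemma Rintegral_itvcc_ge f a b M : continuous f -> a <= b ->
  (forall x, a <= x <= b -> M <= f x) ->
  M * (b - a) <= \int[mu]_(x in `[a, b]) f x.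
Proof.
move=> cf ab fM; rewrite -Rintegral_itvcc_cst//.
by apply: le_Rintegral_itvcc => // x; exact: cst_continuous.
Qed.

Lemma Rintegral_itvcc_normr_le f a b M : continuous f -> a <= b ->
  (forall x, a <= x <= b -> `|f x| <= M) ->
  `|\int[mu]_(x in `[a, b]) f x| <= M * (b - a).
Proof.
move=> cf ab fM; rewrite ler_norml; apply/andP; split.
  rewrite -mulNr; apply: Rintegral_itvcc_ge => // x /fM.
  by rewrite ler_norml => /andP[].
apply: Rintegral_itvcc_le => // x /fM.
by rewrite ler_norml => /andP[].
Qed.

Lemma Rintegral_itvccB f g a b : continuous f -> continuous g ->
  \int[mu]_(x in `[a, b]) (f x - g x) =
  \int[mu]_(x in `[a, b]) f x - \int[mu]_(x in `[a, b]) g x.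
Proof.
by move=> cf cg; rewrite RintegralB//; exact: continuous_integrable_itvcc.
Qed.

Lemma Rintegral_itvccD f g a b : continuous f -> continuous g ->
  \int[mu]_(x in `[a, b]) (f x + g x) =
  \int[mu]_(x in `[a, b]) f x + \int[mu]_(x in `[a, b]) g x.
Proof.
by move=> cf cg; rewrite RintegralD//; exact: continuous_integrable_itvcc.
Qed.

End segment_integral.

Section lipschitz.
Variable R : realType.
Implicit Types (f g : R -> R) (L M s : R).

(** Explicit constants rather than bare continuity: prime sums will be compared with integrals at a
    cost that must be uniform in [v]. *)
Definition lip L f := forall x y, `|f x - f y| <= L * `|x - y|.

Lemma lip_ge0 L f : lip L f -> 0 <= L.
Proof.
move=> /(_ 1 0); rewrite subr0 normr1 mulr1; apply: le_trans.
exact: normr_ge0.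
Qed.

Lemma lip_continuous L f : lip L f -> continuous f.
Proof.
move=> Lf x; have L0 := lip_ge0 Lf.
apply/cvgrPdist_lt => e e0.
have L1 : 0 < L + 1 by lra.
have /cvgrPdist_lt/(_ _ (divr_gt0 e0 L1)) : id z @[z --> x] --> x by exact: cvg_id.
apply: filterS => y /=; rewrite ltr_pdivlMr// => h.
apply: le_lt_trans (Lf _ _) _; apply: le_lt_trans h.
by rewrite mulrC ler_wpM2l// lerDl.
Qed.

Lemma lipP L f : (forall x y, x <= y -> `|f x - f y| <= L * (y - x)) ->
  lip L f.
Proof.
move=> H x y; case: (leP x y) => xy.
  by rewrite (distrC x) (ger0_norm (x := y - x)) ?subr_ge0//; exact: H.
have yx := ltW xy.
by rewrite distrC (ger0_norm (x := x - y)) ?subr_ge0//; exact: H.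
Qed.

Lemma lipM L L' M M' f g : (forall x, `|f x| <= M) ->
  (forall x, `|g x| <= M') ->
  lip L f -> lip L' g -> lip (M * L' + M' * L) (fun x => f x * g x).
Proof.
move=> fM gM fL gL x y.
have -> : f x * g x - f y * g y = f x * (g x - g y) + g y * (f x - f y) by ring.
apply: le_trans (ler_normD _ _) _; rewrite !normrM mulrDl -!mulrA.
by apply: lerD; apply: ler_pM.
Qed.

Lemma lipD L L' f g : lip L f -> lip L' g -> lip (L + L') (fun x => f x + g x).
Proof.
move=> fL gL x y; rewrite opprD addrACA mulrDl.
by apply: le_trans (ler_normD _ _) _; exact: lerD.
Qed.

Lemma lip_comp_sub L f s : lip L f -> lip L (fun t => f (s - t)).
Proof.
move=> fL x y; apply: le_trans (fL _ _) _.
by rewrite opprB addrC addrA subrK distrC.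
Qed.

(** Only arguments at least 1 matter. Freezing the smaller ones at 1 makes the inverse bounded and
    1-Lipschitz on the whole line, so no domain has to be carried along. *)
Definition clamp s : R := Num.max s 1.

Lemma clamp_ge1 s : 1 <= clamp s.
Proof. by rewrite /clamp le_max lexx orbT. Qed.

Lemma clamp_gt0 s : 0 < clamp s.
Proof. exact: lt_le_trans (clamp_ge1 s). Qed.

Lemma clamp_id s : 1 <= s -> clamp s = s.
Proof. by move=> s1; rewrite /clamp max_l. Qed.

Lemma clamp_mono x y : x <= y -> clamp x <= clamp y <= clamp x + (y - x).
Proof.
rewrite /clamp !maxEle => xy.
by have [?|?] := leP x 1; have [?|?] := leP y 1; apply/andP; split; lra.
Qed.

Lemma lip_invclamp : lip 1 (fun s => (clamp s)^-1).
Proof.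
apply: lipP => x y /clamp_mono /andP[h1 h2].
have hx := clamp_gt0 x; have hy := clamp_gt0 y.
have -> : (clamp x)^-1 - (clamp y)^-1 =
  (clamp y - clamp x) / (clamp x * clamp y).
  by field; rewrite !gt_eqF.
rewrite ger0_norm; last by apply: divr_ge0; [lra|rewrite ltW// mulr_gt0].
rewrite ler_pdivrMr ?mulr_gt0// mul1r.
apply: (@le_trans _ _ (y - x)); first lra.
rewrite -[leLHS]mulr1 ler_wpM2l//; first lra.
by rewrite -[leLHS]mulr1 ler_pM//; exact: clamp_ge1.
Qed.

Lemma invclamp_norm s : `|(clamp s)^-1| <= 1.
Proof.
rewrite ger0_norm; last by rewrite invr_ge0 ltW// clamp_gt0.
by rewrite invf_le1 ?clamp_gt0// clamp_ge1.
Qed.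

End lipschitz.

(** * The delay equation *)

Section delay_operator.
Variable R : realType.
Notation mu := (@lebesgue_measure R).
Implicit Types (f g : R -> R) (s v kappa L M : R).

(** For [s >= 1] this is min (1, s - 1), the upper end of the delay integral. *)
Definition horizon s : R := Num.min 1 (clamp s - 1).

Lemma horizon_ge0 s : 0 <= horizon s.
Proof. by rewrite /horizon le_min ler01/= subr_ge0 clamp_ge1. Qed.

Lemma horizon_le1 s : horizon s <= 1.
Proof. by rewrite /horizon ge_min lexx. Qed.

Lemma horizon_le s : horizon s <= clamp s - 1.
Proof. by rewrite /horizon ge_min lexx orbT. Qed.

Lemma horizon_mono x y : x <= y ->
  horizon x <= horizon y <= horizon x + (y - x).
Proof.
move=> /clamp_mono /andP[]; rewrite /horizon !minEle.
move=> ? ?.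
by have [?|?] := leP 1 (clamp x - 1); have [?|?] := leP 1 (clamp y - 1);
  apply/andP; split; lra.
Qed.

(** Since [horizon s <= clamp s - 1], only the values of [f] on [1, clamp s] are read. *)
Definition delay f s := \int[mu]_(t in `[0, horizon s]) f (clamp s - t).

Lemma continuous_comp_sub f s : continuous f -> continuous (fun t => f (s - t)).
Proof.
move=> cf x; apply: (@continuous_comp _ _ _ (fun t => s - t) f); last exact: cf.
by apply: cvgB; [exact: cvg_cst|exact: cvg_id].
Qed.

Lemma delay_ge0 f s : (forall x, 0 <= f x) -> 0 <= delay f s.
Proof. by move=> f0; apply: Rintegral_ge0. Qed.

Lemma delay_norm_le f M s : continuous f -> (forall x, `|f x| <= M) ->
  `|delay f s| <= M.
Proof.
move=> cf fM; have M0 : 0 <= M by apply: le_trans (fM 0).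
apply: (@le_trans _ _ (M * (horizon s - 0))).
  apply: Rintegral_itvcc_normr_le => //; first exact: continuous_comp_sub.
  exact: horizon_ge0.
by rewrite subr0 -[leRHS]mulr1 ler_wpM2l// horizon_le1.
Qed.

(** Moving [s] shifts the integrand, at cost [L], and lengthens the interval of integration, at cost
    [M]. *)
Lemma lip_delay f L M : lip L f -> (forall x, `|f x| <= M) ->
  lip (L + M) (delay f).
Proof.
move=> fL fM; apply: lipP => x y xy.
have cf := lip_continuous fL.
have L0 := lip_ge0 fL.
have M0 : 0 <= M by apply: le_trans (fM 0).
have /andP[h1 h2] := horizon_mono xy.
have hx0 := horizon_ge0 x.
have /andP[c1 c2] := clamp_mono xy.
have cx := @continuous_comp_sub _ (clamp x) cf.
have cy := @continuous_comp_sub _ (clamp y) cf.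
rewrite /delay (Rintegral_itvcc_cat cy hx0 h1) opprD addrA -Rintegral_itvccB//.
rewrite mulrDl; apply: le_trans (ler_normB _ _) _; apply: lerD.
  apply: (@le_trans _ _ (L * (y - x) * (horizon x - 0))).
    apply: Rintegral_itvcc_normr_le => //; first by move=> z; apply: cvgB;
      [exact: cx|exact: cy].
    move=> t _; apply: le_trans (fL _ _) _.
    have -> : clamp x - t - (clamp y - t) = - (clamp y - clamp x) by ring.
    by rewrite normrN ger0_norm ?ler_wpM2l//; lra.
  rewrite subr0 -[leRHS]mulr1 ler_wpM2l ?horizon_le1//.
  by apply: mulr_ge0 => //; lra.
apply: (@le_trans _ _ (M * (horizon y - horizon x))).
  exact: Rintegral_itvcc_normr_le.
by apply: ler_wpM2l => //; lra.
Qed.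

Lemma le_delay f g s : continuous f -> continuous g ->
  (forall x, 1 <= x <= clamp s -> f x <= g x) -> delay f s <= delay g s.
Proof.
move=> cf cg fg; apply: le_Rintegral_itvcc; try exact: continuous_comp_sub.
move=> x /andP[x0 xs]; apply: fg; have h := horizon_le s; apply/andP; split;
  lra.
Qed.

Lemma delayD f g s : continuous f -> continuous g ->
  delay (fun x => f x + g x) s = delay f s + delay g s.
Proof.
by move=> cf cg; rewrite /delay Rintegral_itvccD//; exact: continuous_comp_sub.
Qed.

Lemma delayB f g s : continuous f -> continuous g ->
  delay (fun x => f x - g x) s = delay f s - delay g s.
Proof.
by move=> cf cg; rewrite /delay Rintegral_itvccB//; exact: continuous_comp_sub.
Qed.

Lemma delayZ f r s : continuous f -> delay (fun x => r * f x) s = r * delay f s.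
Proof.
move=> cf; rewrite /delay RintegralZl//; apply: continuous_integrable_itvcc.
exact: continuous_comp_sub.
Qed.

(* For [s >= 1], the length of [(0, 1) `&` (s - 1, s - v)]. *)
Definition window v s : R := Num.max 0 (Num.min (2 - clamp s) (1 - v)).

Lemma window_ge0 v s : 0 <= window v s.
Proof. by rewrite /window le_max lexx. Qed.

Lemma window_le1 v s : window v s <= 1.
Proof.
rewrite /window ge_max ler01/= ge_min; apply/orP; left.
by have := clamp_ge1 s; lra.
Qed.

Lemma max_incr (c x y : R) : x <= y ->
  0 <= Num.max c y - Num.max c x <= y - x.
Proof.
by move=> xy; rewrite !maxEle; have [?|?] := leP c x; have [?|?] := leP c y;
  apply/andP; split; lra.
Qed.

Lemma min_incr (c x y : R) : x <= y ->
  0 <= Num.min y c - Num.min x c <= y - x.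
Proof.
by move=> xy; rewrite !minEle; have [?|?] := leP x c; have [?|?] := leP y c;
  apply/andP; split; lra.
Qed.

Lemma lip_window v : lip 1 (window v).
Proof.
apply: lipP => x y /clamp_mono /andP[h1 h2]; rewrite mul1r ler_norml /window.
have h : 2 - clamp y <= 2 - clamp x by rewrite lerD2l lerN2.
have /andP[a1 a2] := min_incr (1 - v) h.
have /andP[] : 0 <= Num.max 0 (Num.min (2 - clamp x) (1 - v)) -
    Num.max 0 (Num.min (2 - clamp y) (1 - v)) <=
    Num.min (2 - clamp x) (1 - v) - Num.min (2 - clamp y) (1 - v).
  by apply: max_incr; rewrite -subr_ge0.
move: a1 a2; set A := Num.min _ _; set B := Num.min _ _.
set C := Num.max _ _; set D := Num.max _ _ => *.
by apply/andP; split; lra.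
Qed.

(** Controls how far the forcing term is from its value at [v = 0], the one in the equation of
    Dickman's function. *)
Lemma window0_sub v s : 0 <= v -> 0 <= window 0 s - window v s <= v.
Proof.
move=> v0; rewrite /window subr0; set a := 2 - clamp s.
have h : 1 - v <= 1 :> R by lra.
have /andP[] := min_incr a h; rewrite !(minC _ a) => a1 a2.
have /andP[] : 0 <= Num.max 0 (Num.min a 1) - Num.max 0 (Num.min a (1 - v)) <=
    Num.min a 1 - Num.min a (1 - v).
  by apply: max_incr; rewrite -subr_ge0.
move: a1 a2; set A := Num.min _ _; set B := Num.min _ _.
set C := Num.max _ _; set D := Num.max _ _ => *.
by apply/andP; split; lra.
Qed.

(* For [s >= 1], this is [kappa ^ (k + 1) mu_(k + 1) (s, v)]. *)
Fixpoint mu_term kappa v k s {struct k} : R :=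
  kappa * ((clamp s)^-1 * (if k is k'.+1 then delay (mu_term kappa v k') s else window v s)).

Lemma mu_term_ge0 kappa v k s : 0 <= kappa -> 0 <= mu_term kappa v k s.
Proof.
move=> k0; elim: k s => [|k IH] s /=;
  rewrite !mulr_ge0 ?invr_ge0 ?(ltW (clamp_gt0 s))//.
  exact: window_ge0.
exact: delay_ge0.
Qed.

(* The constants are uniform in [v], which depends on [u] in the application. *)
Lemma mu_term_bounded_lip kappa k : 0 <= kappa -> exists M L : R,
  forall v, (forall s, `|mu_term kappa v k s| <=
    M) /\ lip L (mu_term kappa v k).
Proof.
move=> k0; elim: k => [|k [M [L IH]]].
  exists kappa, (kappa * (1 * 1 + 1 * 1)) => v.
  have hb s : `|window v s| <= 1 by rewrite ger0_norm ?window_ge0 ?window_le1.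
  split=> [s|x y] /=.
    rewrite normrM ger0_norm// -[leRHS]mulr1 ler_wpM2l// normrM -[leRHS]mulr1.
    by apply: ler_pM => //; exact: invclamp_norm.
  rewrite -mulrBr normrM ger0_norm// -mulrA ler_wpM2l//.
  exact: (lipM (@invclamp_norm R) hb (@lip_invclamp R) (lip_window v)).
exists (kappa * M), (kappa * (1 * (L + M) + M * 1)) => v.
have [tM tL] := IH v.
have hb s := @delay_norm_le _ _ s (lip_continuous tL) tM.
split=> [s|x y] /=.
  rewrite normrM ger0_norm// ler_wpM2l// normrM -[leRHS]mul1r.
  by apply: ler_pM => //; exact: invclamp_norm.
rewrite -mulrBr normrM ger0_norm// -mulrA ler_wpM2l//.
exact: (lipM (@invclamp_norm R) hb (@lip_invclamp R) (lip_delay tL tM)).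
Qed.

Lemma mu_term_continuous kappa v k : 0 <= kappa ->
  continuous (mu_term kappa v k).
Proof.
move=> /(@mu_term_bounded_lip _ k) [M [L /(_ v)[_ tL]]];
  exact: lip_continuous tL.
Qed.

Definition mu_partial kappa v n s : R := \sum_(0 <= k < n) mu_term kappa v k s.

Lemma mu_partial_continuous kappa v n : 0 <= kappa ->
  continuous (mu_partial kappa v n).
Proof.
move=> k0; elim: n => [|n IH].
  have -> : mu_partial kappa v 0 = cst 0.
    by apply/funext => s; rewrite /mu_partial big_nil.
  exact: cst_continuous.
have -> : mu_partial kappa v n.+1 = (fun s =>
  mu_partial kappa v n s + mu_term kappa v n s).
  by apply/funext => s; rewrite /mu_partial big_nat_recr.
by move=> s; apply: cvgD; [exact: IH|exact: mu_term_continuous].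
Qed.

(** Picard iteration: by linearity of [delay], each partial sum is the image of the preceding one
    under the right-hand side of the delay equation. *)
Lemma mu_partialS kappa v n s : 0 <= kappa ->
  mu_partial kappa v n.+1 s =
  kappa * ((clamp s)^-1 * (window v s + delay (mu_partial kappa v n) s)).
Proof.
move=> k0; elim: n => [|n IH].
  rewrite /mu_partial big_nat1 /=; congr (_ * (_ * _)).
  rewrite /delay (_ : (fun t => _) = fun=> 0); last first.
    by apply/funext => t; rewrite big_nil.
  by rewrite Rintegral_itvcc_cst ?horizon_ge0// mul0r addr0.
rewrite {1}/mu_partial big_nat_recr//= -/(mu_partial kappa v n.+1 s) IH.
rewrite -mulrDr -mulrDr -addrA -delayD; last 2 first.
- exact: mu_partial_continuous.
- exact: mu_term_continuous.
congr (_ * (_ * (_ + delay _ _))); apply/funext => x.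
by rewrite /mu_partial big_nat_recr.
Qed.

Lemma mu_partial_bounded_lip kappa n : 0 <= kappa -> exists M L : R,
  forall v, (forall s, `|mu_partial kappa v n s| <=
    M) /\ lip L (mu_partial kappa v n).
Proof.
move=> k0; elim: n => [|n [M [L IH]]].
  exists 0, 0 => v; split=> [s|x y]; rewrite /mu_partial !big_nil ?normr0//.
  by rewrite subrr normr0 mul0r.
have [M' [L' tb]] := @mu_term_bounded_lip kappa n k0.
exists (M + M'), (L + L') => v.
have [pM pL] := IH v; have [tM tL] := tb v.
split=> [s|x y]; rewrite /mu_partial !big_nat_recr//=.
  by apply: le_trans (ler_normD _ _) _; apply: lerD; [exact: pM|exact: tM].
by have := lipD pL tL x y.
Qed.

Lemma mu_partial_ge0 kappa v n s : 0 <= kappa -> 0 <= mu_partial kappa v n s.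
Proof. by move=> k0; apply: sumr_ge0 => k _; exact: mu_term_ge0. Qed.

Lemma continuous_expR_affine (a : R) :
  continuous ((fun x => expR (a * (x - 1))) : R -> R).
Proof.
move=> t; apply: continuous_comp; last exact: continuous_expR.
apply: cvgM; first exact: cvg_cst.
by apply: cvgB; [exact: cvg_id|exact: cvg_cst].
Qed.

(** Against the weight [expR (2 * kappa * (s - 1))] the delay integral gains [(2 * kappa)^-1]; with
    the factor [kappa] of the equation this is a contraction by 1/2. *)
Lemma delay_expR_le kappa s : 0 < kappa ->
  delay (fun x => expR (2 * kappa * (x - 1))) s <=
  (2 * kappa)^-1 * expR (2 * kappa * (clamp s - 1)).
Proof.
move=> k0; rewrite /delay; have := horizon_ge0 s;
  rewrite le_eqVlt => /predU1P[<-|h0].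
  rewrite set_itv1 Rintegral_set1 mulr_ge0 ?invr_ge0 ?expR_ge0//; lra.
set c := clamp s; pose F t : R :=
  - (2 * kappa)^-1 * expR (2 * kappa * (c - t - 1)).
have dF t : is_derive t (1:R) F (expR (2 * kappa * (c - t - 1))).
  apply: is_derive_eq.
  rewrite /GRing.scale/=; field; lra.
have cF : continuous F.
  by move=> t; apply: differentiable_continuous; apply/derivable1_diffP;
    case: (dF t).
rewrite /Rintegral (@continuous_FTC2 R _ F 0 (horizon s))//; last 3 first.
- apply: continuous_subspaceT => t;
  apply: (@continuous_comp _ _ _ (fun t => 2 * kappa * (c - t - 1)) expR);
    last exact: continuous_expR.
  apply: cvgM; first exact: cvg_cst.
  by apply: cvgB; [apply: cvgB; [exact: cvg_cst|exact: cvg_id]|exact: cvg_cst].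
- split=> [t _||]; first by case: (dF t).
  + by apply: cvg_at_right_filter; exact: cF.
  + by apply: cvg_at_left_filter; exact: cF.
- by move=> t _; rewrite derive1E derive_val.
rewrite /= /F subr0 !mulNr opprK addrC lerBlDr lerDl mulr_ge0 ?expR_ge0 ?invr_ge0//.
lra.
Qed.

(** Each iteration contributes [kappa * (2 * kappa)^-1 = 1 / 2], while [(clamp s)^-1 <= 1]. The
    bound does not involve [v]. *)
Lemma mu_term_decay kappa v k s : 0 < kappa ->
  mu_term kappa v k s <= kappa / 2 ^+ k * expR (2 * kappa * (clamp s - 1)).
Proof.
move=> k0; have k0' := ltW k0.
elim: k s => [|k IH] s /=.
  rewrite expr0 divr1 ler_wpM2l//; apply: (@le_trans _ _ 1).
    rewrite -[leRHS]mulr1 ler_pM ?window_ge0 ?window_le1 ?invr_ge0 ?(ltW (clamp_gt0 s))//.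
    by rewrite invf_le1 ?clamp_gt0// clamp_ge1.
  rewrite -[leLHS]expR0 ler_expR; apply: mulr_ge0;
    last by rewrite subr_ge0 clamp_ge1.
  lra.
rewrite -mulrA ler_wpM2l//.
apply: (@le_trans _ _ (delay (mu_term kappa v k) s)).
  rewrite -[leRHS]mul1r ler_wpM2r ?delay_ge0//; first by move=> ?;
    exact: mu_term_ge0.
  by rewrite invf_le1 ?clamp_gt0// clamp_ge1.
have ce := @continuous_expR_affine (2 * kappa).
apply: (@le_trans _ _ (delay (fun x =>
  kappa / 2 ^+ k * expR (2 * kappa * (x - 1))) s)).
  apply: le_delay; first exact: mu_term_continuous.
    by move=> x; apply: cvgM; [exact: cvg_cst|exact: ce].
  by move=> x /andP[x1 _]; rewrite -[in leRHS](clamp_id x1).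
rewrite delayZ//.
apply: (@le_trans _ _ (kappa / 2 ^+ k * ((2 * kappa)^-1 * expR (2 * kappa * (clamp s - 1))))).
  by rewrite ler_wpM2l ?delay_expR_le// divr_ge0// exprn_ge0.
rewrite exprS le_eqVlt; apply/orP; left; apply/eqP; field.
by rewrite expf_neq0//=; lra.
Qed.

End delay_operator.

(** * Convergence and positivity of the series *)

Section delay_series.
Variable R : realType.
Notation mu := (@lebesgue_measure R).
Implicit Types (f g : R -> R) (s v kappa : R).

(** Sums the geometric bounds [kappa / 2 ^+ k] for n <= k < m; keeping the exact value of that sum
    lets the induction on m - n close. *)
Lemma mu_partial_tail kappa v n m s : 0 < kappa -> (n <= m)%N ->
  mu_partial kappa v m s <= mu_partial kappa v n s +
    kappa * (2 / 2 ^+ n - 2 / 2 ^+ m) * expR (2 * kappa * (clamp s - 1)).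
Proof.
move=> k0 /subnK <-; elim: (m - n)%N => [|d IH].
  by rewrite add0n subrr mulr0 mul0r addr0.
rewrite addSn {1}/mu_partial big_nat_recr//= -/(mu_partial kappa v (d + n) s).
apply: le_trans (lerD IH (mu_term_decay v (d + n) s k0)) _.
rewrite -addrA lerD2l -mulrDl ler_wpM2r ?expR_ge0//.
rewrite exprS le_eqVlt; apply/orP; left; apply/eqP; field.
by rewrite !expf_neq0//=; lra.
Qed.

Lemma mu_partial_tail_le kappa v n m s : 0 < kappa -> (n <= m)%N ->
  mu_partial kappa v m s <= mu_partial kappa v n s +
    2 * kappa / 2 ^+ n * expR (2 * kappa * (clamp s - 1)).
Proof.
move=> k0 nm; apply: le_trans (mu_partial_tail _ _ k0 nm) _.
rewrite lerD2l ler_wpM2r ?expR_ge0// -mulrA mulrCA ler_wpM2l ?(ltW k0)//.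
by rewrite lerBlDr lerDl divr_ge0// exprn_ge0.
Qed.

Lemma mu_partial_nondecreasing kappa v s : 0 <= kappa ->
  nondecreasing_seq (fun n => mu_partial kappa v n s).
Proof.
move=> k0; apply/nondecreasing_seqP => n.
by rewrite /mu_partial big_nat_recr//= lerDl mu_term_ge0.
Qed.

Lemma is_cvg_mu_partial kappa v s : 0 < kappa ->
  cvgn (fun n => mu_partial kappa v n s).
Proof.
move=> k0; apply: nondecreasing_is_cvgn.
  exact: mu_partial_nondecreasing (ltW k0).
exists (mu_partial kappa v 0 s + 2 * kappa / 2 ^+ 0 *
  expR (2 * kappa * (clamp s - 1))) => _ [m _ <-].
exact: mu_partial_tail_le.
Qed.

Lemma mu_partial_le_lim kappa v n s : 0 < kappa ->
  mu_partial kappa v n s <= limn (fun n => mu_partial kappa v n s).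
Proof.
move=> k0; apply: (@nondecreasing_cvgn_le _ (fun n => mu_partial kappa v n s)).
  exact: mu_partial_nondecreasing (ltW k0).
exact: is_cvg_mu_partial.
Qed.

Lemma lim_mu_partial_le kappa v n s : 0 < kappa ->
  limn (fun n => mu_partial kappa v n s) <= mu_partial kappa v n s +
    2 * kappa / 2 ^+ n * expR (2 * kappa * (clamp s - 1)).
Proof.
move=> k0; apply: limr_le; first exact: is_cvg_mu_partial.
by exists n => // m /= nm; exact: mu_partial_tail_le.
Qed.

(** Positivity spreads by steps of 1/4. On [1, 7/4] the window is at least min (1/4, 1 - v); beyond
    7/4, the points [s - t] with t in [1/4, 3/4] fall in the range already treated. *)
Lemma mu_partial_pos kappa v n : 0 < kappa -> v < 1 -> exists2 c : R, 0 < c &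
  forall s, 1 <= s -> s <= 7 / 4 + n%:R / 4 -> c <= mu_partial kappa v n.+1 s.
Proof.
move=> k0 v1; have k0' := ltW k0.
pose m : R := Num.min (1 / 4) (1 - v).
have m0 : 0 < m by rewrite lt_min; apply/andP; split; lra.
have hm s : 1 <= s -> s <= 7 / 4 -> m <= window v s.
  move=> s1 s2; rewrite /window clamp_id// le_max; apply/orP; right.
  rewrite le_min /m !ge_min lexx orbT andbT; apply/orP; left; lra.
have low s n' x : 1 <= s -> x <= window v s + delay (mu_partial kappa v n') s ->
    kappa * (s^-1 * x) <= mu_partial kappa v n'.+1 s.
  move=> s1 h; rewrite mu_partialS// clamp_id// ler_wpM2l// ler_wpM2l//.
  by rewrite invr_ge0; lra.
elim: n => [|n [c c0 IH]].
  exists (kappa * ((7 / 4)^-1 * m)); first by rewrite !mulr_gt0.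
  move=> s s1; rewrite mul0r addr0 => s2.
  apply: le_trans (low s 0%N m s1 _); last first.
    apply: le_trans (hm _ s1 s2) _; rewrite lerDl; apply: delay_ge0 => x.
    exact: mu_partial_ge0.
  rewrite ler_wpM2l// ler_wpM2r ?(ltW m0)// lef_pV2// posrE; lra.
pose S : R := 7 / 4 + n.+1%:R / 4.
have S0 : 0 < S by rewrite /S; have : 0 <= n.+1%:R :> R by []; lra.
(* The factor 1/2 is the length of [1/4, 3/4]. *)
pose d := Num.min m (c / 2).
have d0 : 0 < d by rewrite lt_min m0/=; lra.
exists (kappa * (S^-1 * d)); first by rewrite !mulr_gt0 ?invr_gt0.
move=> s s1 sS.
apply: (@le_trans _ _ (kappa * (s^-1 * d))).
  rewrite ler_wpM2l// ler_wpM2r ?(ltW d0)// lef_pV2// posrE; lra.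
apply: low => //; have [s2|s2] := leP s (7 / 4).
  apply: (@le_trans _ _ m); first by rewrite ge_min lexx.
  apply: le_trans (hm _ s1 s2) _; rewrite lerDl; apply: delay_ge0 => x.
  exact: mu_partial_ge0.
apply: (@le_trans _ _ (c / 2)); first by rewrite ge_min lexx orbT.
rewrite -[leLHS]add0r lerD ?window_ge0// /delay clamp_id//.
have pc : continuous (fun t => mu_partial kappa v n.+1 (s - t)).
  by apply: continuous_comp_sub; exact: mu_partial_continuous.
have h34 : 3 / 4 <= horizon s.
  by rewrite /horizon clamp_id// le_min; apply/andP; split; lra.
have i0 a b : 0 <= \int[mu]_(t in `[a, b]) mu_partial kappa v n.+1 (s - t).
  by apply: Rintegral_ge0 => x _; exact: mu_partial_ge0.
rewrite (@Rintegral_itvcc_cat _ _ 0 (horizon s) (1 / 4))//; try lra.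
rewrite (@Rintegral_itvcc_cat _ _ (1 / 4) (horizon s) (3 / 4))//; last lra.
rewrite -[leLHS]add0r lerD// -[leLHS]addr0 lerD//.
apply: (@le_trans _ _ (c * (3 / 4 - 1 / 4))); first lra.
apply: Rintegral_itvcc_ge => //; first lra.
move=> x /andP[x1 x2]; apply: IH; first lra.
by move: sS; rewrite -natr1; lra.
Qed.

Lemma lim_mu_partial_gt0 kappa v s : 0 < kappa -> v < 1 -> 1 <= s ->
  0 < limn (fun n => mu_partial kappa v n s).
Proof.
(* [n] exceeds [4 * s], so that [s <= 7 / 4 + n%:R / 4]. *)
move=> k0 v1 s1; pose n := (Num.truncn (4 * s)).+1.
have [c c0 /(_ s s1) h] := @mu_partial_pos kappa v n k0 v1.
apply: (lt_le_trans c0); apply: le_trans (mu_partial_le_lim v n.+1 s k0).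
apply: h; have : 4 * s < n%:R by apply: truncnS_gt.
lra.
Qed.

End delay_series.

(** * Comparison with Dickman's function *)

Section dickman.
Variable R : realType.
Notation mu := (@lebesgue_measure R).
Implicit Types (f g : R -> R) (s v : R).

Lemma Rintegral_itvcc_reflect f s a b : continuous f -> a <= b ->
  \int[mu]_(t in `[a, b]) f (s - t) = \int[mu]_(t in `[s - b, s - a]) f t.
Proof.
move=> cf ab; rewrite /Rintegral.
have D : (fun t => s - t : R)^`()%classic = cst (-1).
  apply/funext => z; rewrite derive1E deriveB// derive_val derive_id.
  by rewrite sub0r.
have cs : continuous (fun t => s - t : R).
  by move=> t; apply: cvgB; [exact: cvg_cst|exact: cvg_id].
rewrite (@integration_by_substitution_decreasing _ (fun t => s - t) f a b)//.
- congr fine; apply: eq_integral => x _; congr EFin.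
  by rewrite !fctE D /= opprK mulr1.
- by move=> x y _ _ xy; lra.
- by rewrite D => ? _; exact: cvg_cst.
- by rewrite D; exact: is_cvg_cst.
- by rewrite D; exact: is_cvg_cst.
- split => //.
  + by apply: cvg_at_right_filter; exact: cs.
  + by apply: cvg_at_left_filter; exact: cs.
- exact: continuous_subspaceT.
Qed.

(** A translation is the composite of two reflections. *)
Lemma Rintegral_itvcc_translate f c a b : continuous f -> a <= b ->
  \int[mu]_(t in `[a, b]) f (t - c) = \int[mu]_(t in `[a - c, b - c]) f t.
Proof.
move=> cf ab.
have cg : continuous (fun t => f (- c - t)) by exact: continuous_comp_sub.
transitivity (\int[mu]_(t in `[a, b]) (fun t => f (- c - t)) (0 - t)).
  by apply: eq_Rintegral => t _ /=; congr f; ring.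
rewrite (@Rintegral_itvcc_reflect (fun t => f (- c - t)) 0)//.
rewrite (@Rintegral_itvcc_reflect f (- c))//; last lra.
rewrite (_ : - c - (0 - a) = a - c); last by ring.
by rewrite (_ : - c - (0 - b) = b - c); last by ring.
Qed.

(** The values of Dickman's function at negative arguments are free; extending by the value at 0
    gives a function continuous on the whole line. *)
Definition nonneg_extension f s := f (Num.max s 0).

Lemma nonneg_extension_continuous f :
  {within `[0, +oo[, continuous f} -> continuous (nonneg_extension f).
Proof.
move=> /subspace_continuousP cf x.
have : [set` `[0, +oo[] (Num.max x 0) by rewrite /= in_itv/= le_max lexx orbT.
move=> /cf h; apply: cvg_trans h => W /= W1.
rewrite /nonneg_extension.
have cm : continuous (fun x : R => Num.max x 0).
  by move=> y; apply: continuous_max; [exact: cvg_id|exact: cvg_cst].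
have h : nbhs x (fun y : R => [set` `[0, +oo[] (Num.max y 0) ->
    W (f (Num.max y 0))) := cm x _ W1.
apply: (@filterS _ (nbhs x) _ _ _ _ h) => y; apply.
by rewrite /= in_itv/= le_max lexx orbT.
Qed.

(** Integrating (s rho(s))' = rho(s) - rho(s - 1) from 1 to u gives that u rho(u) is the integral of
    rho over [u - 1, u], which is the delay equation for kappa = 1 and v = 0. *)
Lemma dickman_delay rho u : is_dickman rho -> 1 <= u ->
  u * rho u = window 0 u + delay (nonneg_extension rho) u.
Proof.
move=> [crho drho rho1 rhoE] u1; set r := nonneg_extension rho.
have cr : continuous r := nonneg_extension_continuous crho.
have rE s : 0 <= s -> r s = rho s by move=> s0;
  rewrite /r /nonneg_extension max_l.
have r1 s : 0 <= s -> s <= 1 -> r s = 1 by move=> s0 s1; rewrite rE// rho1// s0.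
have int1 a b : 0 <= a -> a <= b -> b <= 1 ->
  \int[mu]_(t in `[a, b]) r t = b - a.
  move=> a0 ab b1; rewrite -[RHS]mul1r -Rintegral_itvcc_cst//.
  apply: eq_Rintegral => t; rewrite inE/= in_itv/= => /andP[h1 h2].
  by apply: r1; lra.
(* For u < 2 the segment is cut at 1: below 1 the integrand is 1 and yields the window, above 1 it
   yields the delay integral. *)
suff main : u * rho u = \int[mu]_(t in `[u - 1, u]) r t.
  rewrite main /delay Rintegral_itvcc_reflect ?horizon_ge0// clamp_id// subr0.
  rewrite /horizon /window clamp_id// subr0.
  have [h|h] := leP 1 (u - 1).
    rewrite max_l ?add0r// ge_min; apply/orP; left; lra.
  rewrite min_l; last lra.
  rewrite max_r; last lra.
  rewrite (@Rintegral_itvcc_cat _ _ _ _ 1)//; last lra.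
  rewrite int1//; [|lra..].
  rewrite (_ : u - (u - 1) = 1); last by ring.
  by congr (_ + _); ring.
have [<-|/eqP u1'] := eqVneq 1 u;
  first by rewrite subrr mul1r int1// subr0 rho1// ler01 lexx.
have {}u1' : 1 < u by rewrite lt_neqAle u1 andbT; exact/eqP.
have crt c : continuous (fun t => r (t - c)).
  move=> x; apply: (@continuous_comp _ _ _ (fun t => t - c) r); last exact: cr.
  by apply: cvgB; [exact: cvg_id|exact: cvg_cst].
pose F s := s * r s.
have cF : continuous F by move=> s; apply: cvgM; [exact: cvg_id|exact: cr].
have dF s : 1 < s -> is_derive s (1:R) F (r s - r (s - 1)).
  move=> s1.
  apply: (@near_eq_is_derive _ _ _ (fun s => s * rho s)).
    near=> z; rewrite /F rE//.
    near: z; exists (s - 1) => /=; first lra.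
    move=> z /= h; have : s - z < s - 1 by apply: le_lt_trans h;
      exact: ler_norm.
    lra.
  have dr : is_derive s (1:R) rho (rho^`()%classic s).
    by split; [exact: drho|rewrite derive1E].
  apply: is_derive_eq.
  rewrite !rE; [|lra..].
  by rewrite /GRing.scale/=; have := rhoE _ s1; lra.
have H : \int[mu]_(s in `[1, u]) (r s - r (s - 1)) = F u - F 1.
  rewrite /Rintegral (@continuous_FTC2 R _ F 1 u u1')//.
  - by apply: continuous_subspaceT => t; apply: cvgB; [exact: cr|exact: crt].
  - split=> [t||].
    + by rewrite in_itv/= => /andP[t1 _]; case: (dF _ t1).
    + by apply: cvg_at_right_filter; exact: cF.
    + by apply: cvg_at_left_filter; exact: cF.
  - move=> t; rewrite in_itv/= => /andP[t1 _].
    by have := dF _ t1; rewrite derive1E => dt; rewrite derive_val.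
move: H; rewrite Rintegral_itvccB// Rintegral_itvcc_translate//.
rewrite subrr /F mul1r (r1 1)// rE; last lra.
have i1 : \int[mu]_(t in `[0, 1]) r t = 1 by rewrite int1// subr0.
have c1 := @Rintegral_itvcc_cat R r 0 u 1 cr ler01 u1.
have h0 : 0 <= u - 1 by lra.
have h1 : u - 1 <= u by lra.
have := @Rintegral_itvcc_cat R r 0 u (u - 1) cr h0 h1.
rewrite c1 i1; lra.
Unshelve. all: by end_near. Qed.

(** The two forcing terms differ by at most [v], and each iteration halves the weighted error: the
    initial error [M] becomes [M / 2 ^+ n], and [2 * v] is the fixed point of e = v + e / 2. *)
Lemma mu_partial_dickman rho M v n s : is_dickman rho -> 0 <= v -> v < 1 ->
  (forall x, 1 <= x -> x <= s -> `|rho x| <= M) -> 1 <= s ->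
  `|rho s - mu_partial 1 v n s| <= (2 * v + M / 2 ^+ n) * expR (2 * (s - 1)).
Proof.
move=> drho v0 v1 rM s1.
have M0 : 0 <= M by apply: le_trans (rM _ s1 (lexx _)).
set r := nonneg_extension rho.
have cr : continuous r by case: drho => /nonneg_extension_continuous.
have rE x : 1 <= x -> r x = rho x.
  by move=> x1; rewrite /r /nonneg_extension max_l//; lra.
have p0 k : continuous (mu_partial (1 : R) v k) by exact: mu_partial_continuous.
have e1 (x : R) : 1 <= x -> 1 <= expR (2 * (x - 1)).
  by move=> x1; rewrite -[leLHS]expR0 ler_expR; lra.
elim: n s s1 rM => [|n IH] s s1 rM.
  rewrite /mu_partial big_nil subr0 expr0 divr1.
  apply: le_trans (rM _ s1 (lexx _)) _.
  rewrite -[leLHS]mulr1; apply: ler_pM => //; [lra|exact: e1].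
set E := 2 * v + M / 2 ^+ n.
have E0 : 0 <= E by rewrite addr_ge0 ?mulr_ge0// divr_ge0// exprn_ge0.
have ce : continuous ((fun x => E * expR (2 * 1 * (x - 1))) : R -> R).
  by move=> t; apply: cvgM; [exact: cvg_cst|exact: continuous_expR_affine].
have hE : delay (fun x => E * expR (2 * 1 * (x - 1))) s <=
    (v + M / 2 ^+ n.+1) * expR (2 * (s - 1)).
  rewrite delayZ; last exact: continuous_expR_affine.
  apply: le_trans (ler_wpM2l E0 (delay_expR_le s ltr01)) _.
  rewrite clamp_id// mulr1 mulrA ler_wpM2r ?expR_ge0// /E exprS.
  rewrite le_eqVlt; apply/orP; left; apply/eqP; field.
  by rewrite expf_neq0.
have hrho := dickman_delay drho s1.
have h0 := window0_sub s v0.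
have hd : `|delay r s - delay (mu_partial 1 v n) s| <=
    (v + M / 2 ^+ n.+1) * expR (2 * (s - 1)).
  have key x : 1 <= x <= clamp s ->
      `|r x - mu_partial 1 v n x| <= E * expR (2 * 1 * (x - 1)).
    rewrite (clamp_id s1) => /andP[x1 xs]; rewrite rE// mulr1; apply: IH => //.
    by move=> y y1 yx; apply: rM => //; exact: le_trans xs.
  have cb : continuous (fun x => r x - mu_partial 1 v n x).
    by move=> t; apply: cvgB; [exact: cr|exact: p0].
  rewrite -delayB//; rewrite ler_norml; apply/andP; split.
    rewrite -[leRHS]opprK lerN2; apply: le_trans hE.
    have <- : delay (fun x => -1 * (r x - mu_partial 1 v n x)) s =
        - delay (fun x => r x - mu_partial 1 v n x) s by rewrite delayZ// mulN1r.
    apply: le_delay => // [t|x /key].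
      by apply: cvgM; [exact: cvg_cst|exact: cb].
    by rewrite ler_norml mulN1r => /andP[]; lra.
  apply: le_trans hE; apply: le_delay => // x /key.
  by rewrite ler_norml => /andP[].
have -> : rho s - mu_partial 1 v n.+1 s = s^-1 *
    ((window 0 s - window v s) + (delay r s - delay (mu_partial 1 v n) s)).
  rewrite mu_partialS// clamp_id// mul1r.
  have -> : rho s = s^-1 * (s * rho s) by field; lra.
  by rewrite hrho -/r; ring.
rewrite normrM ger0_norm ?invr_ge0; last lra.
rewrite -[leRHS]mul1r; apply: ler_pM => //.
- by rewrite invr_ge0; lra.
- by rewrite invf_le1//; lra.
apply: le_trans (ler_normD _ _) _.
rewrite ger0_norm; last by case/andP: h0.
have := e1 _ s1; set X := expR _ in hd *; move: hd h0 => hd /andP[_ h0] X1.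
have : v <= v * X by rewrite -[leLHS]mulr1 ler_wpM2l.
by move: hd; rewrite !mulrDl; lra.
Qed.

Lemma dickman_bounded rho u : is_dickman rho -> exists M : R,
  forall x, 1 <= x -> x <= u -> `|rho x| <= M.
Proof.
move=> [/nonneg_extension_continuous cr _ _ _].
have := @continuous_compact R R (nonneg_extension rho) `[1, u].
move=> /(_ (continuous_subspaceT cr) (@segment_compact _ _ _))/compact_bounded.
move=> [M [_ /(_ (M + 1))]]; rewrite ltrDl ltr01 => /(_ isT) H.
exists (M + 1) => x x1 xu; have := H (rho x); apply; exists x.
  by rewrite /= in_itv/= x1 xu.
by rewrite /nonneg_extension max_l//; lra.
Qed.

(** Letting n tend to infinity removes [M] and leaves a bound linear in [v]. *)
Lemma lim_mu_partial_dickman rho v u M : is_dickman rho -> 0 <= v -> v < 1 ->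
  (forall x, 1 <= x -> x <= u -> `|rho x| <= M) -> 1 <= u ->
  `|rho u - limn (fun n => mu_partial 1 v n u)| <= 2 * v * expR (2 * (u - 1)).
Proof.
move=> drho v0 v1 rM u1.
have pc := @is_cvg_mu_partial R 1 v u ltr01.
have l1 : `|rho u - mu_partial 1 v n u| @[n --> \oo] -->
    `|rho u - limn (fun n => mu_partial 1 v n u)|.
  by apply: cvg_norm; apply: cvgB; [exact: cvg_cst|exact: pc].
have l2 : (2 * v + M / 2 ^+ n) * expR (2 * (u - 1)) @[n --> \oo] -->
    (2 * v + M * 0) * expR (2 * (u - 1)).
  apply: cvgM; last exact: cvg_cst; apply: cvgD; first exact: cvg_cst.
  apply: cvgM; first exact: cvg_cst.
  under eq_fun do rewrite -exprVn.
  by apply: cvg_expr; rewrite ger0_norm//; lra.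
rewrite mulr0 addr0 in l2.
apply: ler_cvg_to l1 l2 _; apply: nearW => n.
exact: mu_partial_dickman.
Qed.

End dickman.

(** * Iterated integrals over the domains [Vk] *)

Section simplex_integrals.
Variable R : realType.
Notation mu := (@lebesgue_measure R).
Notation RT := (measurableTypeR R).
Implicit Types (u v s a : R) (k n : nat).

Lemma psum0 n (t : n.-tuple R) : psum t 0 = 0.
Proof. by rewrite /psum big_pred0. Qed.

Lemma psum_cons n a (t : n.-tuple R) j :
  psum [tuple of a :: t] j.+1 = a + psum t j.
Proof.
rewrite /psum big_mkcond big_ord_recl /= tnth0; congr (_ + _).
by rewrite [RHS]big_mkcond; apply: eq_bigr => i _ /=; rewrite tnthS.
Qed.

Lemma psum_ge0 n (t : n.-tuple R) j : (forall i, 0 < tnth t i < 1) ->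
  0 <= psum t j.
Proof. by move=> t0; apply: sumr_ge0 => i _; have /andP[/ltW] := t0 i. Qed.

Lemma psum_mono n (t : n.-tuple R) i j : (forall i, 0 < tnth t i < 1) ->
  (i <= j)%N -> psum t i <= psum t j.
Proof.
move=> t0 ij; rewrite /psum big_mkcond [leRHS]big_mkcond; apply: ler_sum => l _.
have /andP[/ltW t1 _] := t0 l.
by case: ifPn => [li|_]; [rewrite (leq_trans li ij)|case: ifP].
Qed.

Lemma fk0 u n (t : n.-tuple R) : fk 0 u t = 1.
Proof. by rewrite /fk big_geq. Qed.

Lemma fk_cons k u n a (t : n.-tuple R) :
  fk k.+1 u [tuple of a :: t] = (u - a)^-1 * fk k (u - a) t.
Proof.
rewrite /fk big_nat_recl// psum_cons psum0 addr0; congr (_ * _).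
apply: eq_big_nat => i /andP[]; case: i => // i _ _.
by rewrite psum_cons opprD addrA.
Qed.

(** Fixing the first coordinate replaces [u] by [u - a] and leaves [v] as it is; this is why [v],
    and not theta, is held fixed in the recursion. *)
Lemma Vk_cons k u v a (t : k.+1.-tuple RT) :
  Vk u v (([tuple of a :: t]) : k.+2.-tuple RT) <->
  0 < a < 1 /\ Vk (u - a) v t.
Proof.
rewrite /Vk /= !psum_cons; split=> [[h [h1 [h2 h3]]]|[a01 [h [h1 [h2 h3]]]]].
  split; first by have := h ord0; rewrite tnth0.
  split=> [i|]; first by have := h (lift ord0 i); rewrite tnthS.
  by split; [lra|split; lra].
split=> [i|].
  by have [j ->|->] := unliftP ord0 i; [rewrite tnthS|rewrite tnth0].
by split; [lra|split; lra].
Qed.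

Lemma Vk_le1 k u v (t : k.+1.-tuple RT) : u <= 1 -> ~ Vk u v t.
Proof. by move=> u1 [/(@psum_ge0 _ _ k) /= h [h1 _]]; lra. Qed.

Lemma measurable_psum n j : measurable_fun [set: n.-tuple RT] (fun t =>
  psum t j : RT).
Proof.
rewrite /psum (_ : (fun t => _) = fun t : n.-tuple RT =>
    \sum_(i <- index_enum 'I_n) (if (i < j)%N then tnth t i else 0));
      last first.
  by apply/funext => t; rewrite big_mkcond.
apply: measurable_sum => i.
have [ij|_] := boolP (i < j)%N; last exact: measurable_cst.
exact: measurable_tnth.
Qed.

Lemma measurable_lt_cst d (T : measurableType d) (g : T -> RT) (c : R) :
  measurable_fun setT g -> measurable [set t | g t < c].
Proof.
move=> mg; have := mg measurableT `]-oo, c[%classic (measurable_itv _).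
by rewrite setTI; congr measurable; apply/seteqP.
Qed.

Lemma measurable_cst_lt d (T : measurableType d) (g : T -> RT) (c : R) :
  measurable_fun setT g -> measurable [set t | c < g t].
Proof.
move=> mg; have := mg measurableT `]c, +oo[%classic (measurable_itv _).
rewrite setTI; congr measurable; apply/seteqP.
by split=> t /=; rewrite in_itv/= andbT.
Qed.

Lemma measurable_Vk k u v : measurable (@Vk R k u v).
Proof.
have -> : @Vk R k u v =
    (\bigcap_(i in [set: 'I_k]) ([set t : k.-tuple RT | 0 < tnth t i] `&`
       [set t | tnth t i < 1])) `&`
    ([set t | psum t k.-1 < u - 1] `&`
    ([set t | u - 1 < psum t k] `&` [set t | psum t k < u - v])).
  apply/seteqP; split=> t /=.
    move=> [h h']; split => // i _; have /andP[h1 h2] := h i; by split.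
  move=> [h h']; split => // i; have [] := h i I => /= -> ->; by [].
apply: measurableI; last apply: measurableI; last apply: measurableI.
- apply: fin_bigcap_measurable => // i _; apply: measurableI.
    by apply: measurable_cst_lt; exact: measurable_tnth.
  by apply: measurable_lt_cst; exact: measurable_tnth.
- by apply: measurable_lt_cst; exact: measurable_psum.
- by apply: measurable_cst_lt; exact: measurable_psum.
- by apply: measurable_lt_cst; exact: measurable_psum.
Qed.

(* On [Vk] the factors of [fk] have denominators above 1, so that the clamped
   (hence continuous) inverse may replace the actual one. *)
Lemma measurable_fk_Vk k u v :
  measurable_fun (@Vk R k.+1 u v) (fun t => fk k u t : RT).
Proof.
apply: (eq_measurable_fun (fun t : k.+1.-tuple RT =>
    \prod_(1 <= i < k.+1) (clamp (u - psum t i))^-1 : RT)) => [t|].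
  rewrite inE => -[t01 [/= h _]]; apply: eq_big_nat => i /andP[_ ik].
  rewrite clamp_id//; have := @psum_mono _ _ i k t01; rewrite -ltnS => /(_ ik).
  by lra.
apply: measurable_funTS; apply: measurable_prod => i _.
apply: (@measurableT_comp _ _ _ _ _ _ (fun s : RT => (clamp s)^-1 : RT)).
  by apply: continuous_measurable_fun; exact: lip_continuous (@lip_invclamp R).
apply: measurable_funB; first exact: measurable_cst.
exact: measurable_psum.
Qed.

Lemma fk_Vk_ge0 k u v (t : k.+1.-tuple RT) : Vk u v t -> 0 <= fk k u t.
Proof.
move=> [t01 [/= h _]]; rewrite /fk big_nat_cond; apply: prodr_ge0 => i.
rewrite andbT => /andP[_ ik]; rewrite invr_ge0.
by have := @psum_mono _ _ i k t01; rewrite -ltnS => /(_ ik); lra.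
Qed.

(** The integral in mu_(k + 1), without its factor 1 / u, and extended-valued so that Tonelli's
    theorem applies directly. *)
Definition simplex_integral k u v : \bar R :=
  (\int[lebesgue_tuple R k.+1]_(t in @Vk R k.+1 u v) (fk k u t)%:E)%E.

Lemma simplex_integral_le1 k u v : u <= 1 -> simplex_integral k u v = 0%E.
Proof.
move=> u1; rewrite /simplex_integral (_ : Vk _ _ = set0) ?integral_set0//.
by apply/seteqP; split=> // t /(Vk_le1 u1).
Qed.

(** Tonelli in the first variable: the measure on tuples is the image of a product, and both the
    domain and the integrand split off that variable. *)
Lemma simplex_integralS k u v : simplex_integral k.+1 u v =
  (\int[mu]_(a in `]0%R,
    1%R[) ((u - a)^-1%:E * simplex_integral k (u - a) v))%E.
Proof.
rewrite /simplex_integral [lebesgue_tuple _ k.+2]/= /tuple_cons_measure.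
have /measurable_EFinP mF := @measurable_fk_Vk k.+1 u v.
have mc := @measurable_cons_pair R k.+1.
have mV : measurable (@cons_pair R k.+1 @^-1` @Vk R k.+2 u v).
  by rewrite -[X in measurable X]setTI; apply: mc => //; exact: measurable_Vk.
rewrite (@ge0_integral_pushforward _ _ _ _ _ _ mc)//; last 2 first.
- exact: measurable_Vk.
- by move=> t; rewrite inE => /fk_Vk_ge0; rewrite lee_fin.
rewrite integral_mkcond fubini_tonelli1; last 2 first.
- apply/(measurable_restrictT _ _).1 => //.
  apply: (measurable_comp _ _ mF); first exact: measurable_Vk.
    by move=> _ [p Vp <-].
  exact: measurable_funTS.
- move=> p; rewrite patchE; case: ifPn => //; rewrite inE /= => /fk_Vk_ge0.
  by rewrite lee_fin.
rewrite [RHS]integral_mkcond; apply: eq_integral => a _.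
rewrite /fubini_F /= patchE; case: ifPn; rewrite ?inE ?notin_setE /= in_itv/=.
  (* For [u - a <= 1] the slice is empty and both sides vanish; otherwise [(u - a)^-1] is positive
     and comes out of the integral. *)
  move=> a01; have [ua|ua] := leP (u - a) 1.
    rewrite [X in (_ * X)%E](simplex_integral_le1 k v ua) mule0.
    apply: integral0_eq => t _.
    rewrite patchE; case: ifPn => //; rewrite inE /= => /Vk_cons[_].
    by move/(Vk_le1 ua).
  rewrite -ge0_integralZl_EFin//; last 4 first.
  - exact: measurable_Vk.
  - by move=> t /fk_Vk_ge0; rewrite lee_fin.
  - by apply/measurable_EFinP; exact: measurable_fk_Vk.
  - by rewrite invr_ge0; lra.
  rewrite [RHS]integral_mkcond; apply: eq_integral => t _.
  rewrite !patchE; case: ifPn; rewrite ?inE ?notin_setE /=.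
    move=> /Vk_cons[_ Vt]; rewrite ifT ?inE//.
    by rewrite /cons_pair/= fk_cons EFinM.
  move=> nV; rewrite ifF//; apply/negP; rewrite inE => Vt.
  by apply: nV; apply/Vk_cons.
move=> a01; apply: integral0_eq => t _.
by rewrite patchE; case: ifPn => //; rewrite inE /= => /Vk_cons[].
Qed.

Lemma lebesgue_measure_window u v : 0 <= v -> 1 <= u ->
  mu (`]0, 1[%classic `&` `]u - 1, u - v[%classic : set R) = (window v u)%:E.
Proof.
move=> v0 u1.
have -> : (`]0, 1[%classic `&` `]u - 1, u - v[%classic : set R) =
    `]u - 1, (Num.min 1 (u - v))[%classic.
  apply/seteqP; split=> t /=; rewrite !in_itv/= lt_min.
    by move=> [/andP[? ?] /andP[? ?]]; apply/and3P; split.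
  move=> /and3P[? ? ?]; split; apply/andP; split => //; lra.
have E : Num.min (2 - u) (1 - v) = Num.min 1 (u - v) - (u - 1).
  rewrite !minEle; have [?|?] := leP 1 (u - v);
  by have [?|?] := leP (2 - u) (1 - v); lra.
rewrite lebesgue_measure_itv/= lte_fin /window clamp_id// E maxEle subr_ge0.
set m := Num.min _ _; have [h|h|->] := ltgtP (u - 1) m => //=.
by rewrite subrr.
Qed.

Lemma psum1 (t : 1.-tuple R) : psum t 1 = tnth t ord0.
Proof. by rewrite /psum big_mkcond big_ord1. Qed.

Lemma simplex_integral0 u v : 0 <= v -> 1 < u ->
  simplex_integral 0 u v = (window v u)%:E.
Proof.
move=> v0 u1; rewrite /simplex_integral.
under eq_integral do rewrite fk0.
rewrite integral_cst; last exact: measurable_Vk.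
rewrite mul1e (_ : @Vk R 1 u v = [set t | forall i : 'I_1,
    (`]0, 1[ `&` `]u - 1, u - v[)%classic (tnth t i)]); last first.
  apply/seteqP; split=> t.
    move=> [h [_ [h2 h3]]] i; move: h2 h3; rewrite /= psum1 (ord1 i).
    by rewrite !in_itv/= => -> ->; rewrite h.
  move=> h; split=> [i|].
    by have [] := h i; rewrite /= in_itv.
  have [_ ] := h ord0; rewrite /= in_itv/= => /andP[h1 h2].
  by rewrite psum0 psum1 h1 h2; split => //; lra.
have := @lebesgue_tuple_box R 1 (fun=> (`]0, 1[ `&` `]u - 1, u - v[)%classic).
rewrite big_ord1 => box; apply: (etrans (box _)).
  by move=> i; exact: measurableI.
by rewrite lebesgue_measure_window// ltW.
Qed.



(** In the induction the factor [u - a] given by the hypothesis cancels the [(u - a)^-1] of the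
    slice, which leaves exactly the delay integral. *)
Lemma simplex_integral_term k u v : 0 <= v -> 1 < u ->
  simplex_integral k u v = (u * mu_term 1 v k u)%:E.
Proof.
move=> v0; elim: k u => [|k IH] u u1.
  rewrite simplex_integral0//= mul1r clamp_id ?ltW// mulrA divff ?mul1r//; lra.
have u1' := ltW u1.
rewrite simplex_integralS.
have tc : continuous (fun t => mu_term 1 v k (u - t)).
  by apply: continuous_comp_sub; exact: mu_term_continuous.
transitivity (\int[mu]_(a in `]0%R, (horizon u)[) (mu_term 1 v k (u - a))%:E)%E.
  rewrite integral_mkcond [RHS]integral_mkcond; apply: eq_integral => a _.
  rewrite !patchE !mem_setE !in_itv/= /horizon clamp_id// lt_min andbA.
  case: ifPn => //= a01; have [ua|ua] := ltP a (u - 1).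
    rewrite IH; last lra.
    by rewrite -EFinM mulrA mulVf ?mul1r//; lra.
  by rewrite simplex_integral_le1 ?mule0//; lra.
rewrite integral_itv_bndo_bndc; last first.
  apply: measurable_funTS; apply/measurable_EFinP.
  exact: continuous_measurable_fun.
rewrite integral_itv_obnd_cbnd; last first.
  apply: measurable_funTS; apply/measurable_EFinP.
  exact: continuous_measurable_fun.
rewrite /= mul1r clamp_id// mulrA divff ?mul1r; last lra.
rewrite /delay /Rintegral clamp_id// fineK//.
apply: integrable_fin_num => //; exact: continuous_integrable_itvcc.
Qed.

Lemma mu_termZ kappa v k u : 0 <= kappa ->
  mu_term kappa v k u = kappa ^+ k.+1 * mu_term 1 v k u.
Proof.
move=> k0; elim: k u => [|k IH] u /=; first by rewrite mul1r expr1.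
rewrite (_ : mu_term kappa v k = fun s => kappa ^+ k.+1 * mu_term 1 v k s);
  last first.
  by apply/funext => s; rewrite IH.
by rewrite delayZ; [rewrite [in RHS]exprS; ring|exact: mu_term_continuous].
Qed.

Lemma muk_mu_term kappa u v k : 0 < kappa -> 0 <= v -> 1 <= u ->
  kappa ^+ k.+1 * muk k.+1 u v = mu_term kappa v k u.
Proof.
move=> k0 v0 u1; rewrite mu_termZ ?ltW//; congr (_ * _).
case: k => [|k]; rewrite /muk /=.
  by rewrite lebesgue_measure_window// clamp_id// mul1r.
rewrite (_ : \int[_]_(_ in _) _ = fine (simplex_integral k.+1 u v))//.
(* At [u = 1] both sides are 0: the domain is empty and the horizon is 0. *)
move: u1; rewrite le_eqVlt => /predU1P[<-|u1].
  rewrite simplex_integral_le1// /delay /horizon clamp_id// subrr min_r//.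
  by rewrite set_itv1 Rintegral_set1 !mulr0.
rewrite simplex_integral_term//.
transitivity (u^-1 * (u * mu_term 1 v k.+1 u)) => //.
by rewrite mulKf// gt_eqF//; lra.
Qed.

Lemma rho_tk_lim theta kappa u : 0 < kappa -> theta < 1 -> 1 <= u ->
  rho_tk theta kappa u = limn (fun n => mu_partial kappa ((1 - theta) * u) n u).
Proof.
move=> k0 th1 u1; rewrite /rho_tk /mu_kappa.
have v0 : 0 <= (1 - theta) * u by rewrite mulr_ge0//; lra.
set v := (1 - theta) * u;
  pose S n : R := \sum_(1 <= k < n) kappa ^+ k * muk k u v.
(* The sum defining [mu_kappa] starts at k = 1, hence the shift by one. *)
have : S n.+1 @[n --> \oo] --> limn (fun n => mu_partial kappa v n u).
  rewrite (_ : (fun n => S n.+1) = (fun n => mu_partial kappa v n u)).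
    exact: is_cvg_mu_partial.
  apply/funext => n; rewrite /S big_add1 /mu_partial; apply: eq_bigr => k _.
  exact: muk_mu_term.
by rewrite (cvg_shiftS S) => h; exact: cvg_lim h.
Qed.

End simplex_integrals.

(** * Removing primes from the elements of a finite set *)

Section prime_peeling.
Variable R : realType.
Implicit Types (P E : seq nat) (t w a b : nat -> R) (v s u y : R).

(* [d] is the product of the primes removed so far, [E] lists them, and [s] is
   the logarithm in base [y] of an upper bound for the remaining cofactor; a
   removal stops once that bound drops below [y], and is discarded when it
   drops to [y ^ v], i.e. when [d] would exceed the sieving level. *)
Fixpoint peel P t v a K d s E : R :=
  if K is K'.+1 then
    s^-1 * \sum_(p <- P | p \notin E) t p *
      (if s - 1 < t p < s - v then a (d * p)%N
       else if t p < s - 1 then peel P t v a K' (d * p)%N (s - t p) (p :: E)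
       else 0)
  else 0.

(** What [peel] becomes for a multiplicative density: the contribution of [d] factors out, and that
    of [p] is absorbed into the weight [w p]. *)
Fixpoint main_term P t v w K s E : R :=
  if K is K'.+1 then
    s^-1 * \sum_(p <- P | p \notin E) w p *
      (if s - 1 < t p < s - v then 1
       else if t p < s - 1 then main_term P t v w K' (s - t p) (p :: E) else 0)
  else 0.

Lemma peelD P t v a b K d s E x z :
  peel P t v (fun e => x * a e + z * b e) K d s E =
  x * peel P t v a K d s E + z * peel P t v b K d s E.
Proof.
elim: K d s E => [|K IH] d s E /=; first by rewrite !mulr0 addr0.
rewrite !(mulrCA _ s^-1) -mulrDr; congr (_ * _).
rewrite !mulr_sumr -big_split/=; apply: eq_bigr => p _.
by case: ifP => _; last case: ifP => _; rewrite ?IH; ring.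
Qed.

Lemma peel_sum (I : Type) (r : seq I) (c : I -> R) (f : I -> nat -> R)
    P t v K d s E :
  peel P t v (fun e => \sum_(i <- r) c i * f i e) K d s E =
  \sum_(i <- r) c i * peel P t v (f i) K d s E.
Proof.
elim: r => [|i r IH].
  rewrite big_nil -[RHS](mul0r (peel P t v (fun=> 0) K d s E)) -[RHS]addr0.
  rewrite -[X in _ + X](mul0r (peel P t v (fun=> 0) K d s E)) -peelD.
  by congr peel; apply/funext => e; rewrite big_nil; ring.
rewrite big_cons -IH -[X in _ + X]mul1r -peelD.
by congr peel; apply/funext => e; rewrite big_cons mul1r.
Qed.

Lemma peel_eq0 P t v a K d s E : (forall e, a (d * e)%N = 0) ->
  peel P t v a K d s E = 0.
Proof.
elim: K d s E => [//|K IH] d s E a0 /=; rewrite big1 ?mulr0// => p _.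
rewrite a0 IH; first by rewrite !if_same mulr0.
by move=> e; rewrite -mulnA a0.
Qed.

Lemma main_term_ge0 P t v w K s E : {in P, forall p, 0 <= w p} -> 1 <= s ->
  0 <= main_term P t v w K s E.
Proof.
move=> w0; elim: K s E => [//|K IH] s E s1 /=.
apply: mulr_ge0; first by rewrite invr_ge0; lra.
rewrite big_seq_cond; apply: sumr_ge0 => p /andP[pP _].
apply: mulr_ge0; first exact: w0.
case: ifP => // _; case: ifP => // h; apply: IH; lra.
Qed.

(** The list [E] forbids repeated primes, so [d] and the next prime are always coprime and the
    density factors. *)
Lemma peel_multiplicative P t v (g : nat -> R) K d s E :
  multiplicative_arith g -> {in P, forall p, prime p} -> (0 < d)%N ->
  {in P, forall p, p \notin E -> coprime d p} ->
  peel P t v (fun e => g e / e%:R) K d s E =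
  g d / d%:R * main_term P t v (fun p => t p * (g p / p%:R)) K s E.
Proof.
move=> [_ gM] Pp; elim: K d s E => [|K IH] d s E d0 dE /=;
  first by rewrite mulr0.
rewrite mulrCA; congr (_ * _); rewrite mulr_sumr big_seq_cond [RHS]big_seq_cond.
apply: eq_bigr => p /andP[pP pE].
have p0 : (0 < p)%N by exact/prime_gt0/Pp.
have E1 : g (d * p)%N / (d * p)%:R = g d / d%:R * (g p / p%:R).
  by rewrite gM//; [rewrite natrM invfM; ring|exact: dE].
case: ifP => _; first by rewrite E1; ring.
case: ifP => _; last by rewrite !mulr0.
rewrite IH ?E1 ?muln_gt0 ?d0//; first by ring.
move=> q qP; rewrite inE negb_or => /andP[qp qE].
rewrite coprimeMl dE//= prime_coprime ?Pp// dvdn_prime2 ?Pp//.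
by rewrite eq_sym.
Qed.

Lemma dvdn_prod_primes P m : uniq P -> {in P, forall p, prime p} ->
  (\prod_(p <- P | p %| m) p %| m)%N.
Proof.
elim: P => [|p P IH] /=; first by rewrite big_nil dvd1n.
move=> /andP[pP uP] Pp; rewrite big_cons.
have Pp' : {in P, forall q, prime q} by move=> q qP; rewrite Pp// inE qP orbT.
have {}IH := IH uP Pp'; case: ifP => // pm.
rewrite Gauss_dvd ?pm//; rewrite big_seq_cond.
elim/big_rec: _ => [|q x /andP[qP _] cx]; first exact: coprimen1.
rewrite coprimeMr cx andbT.
have pp : prime p by apply: Pp; exact: mem_head.
have pq : prime q by exact: Pp'.
by rewrite prime_coprime// dvdn_prime2//; apply: contraNneq pP => ->.
Qed.

Lemma sum_ln_primes_le P m : uniq P -> {in P, forall p, prime p} -> (0 < m)%N ->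
  \sum_(p <- P | (p %| m)%N) ln (p%:R : R) <= ln m%:R.
Proof.
move=> uP Pp m0.
have -> : \sum_(p <- P | (p %| m)%N) ln (p%:R : R) =
    ln (\prod_(p <- P | (p %| m)%N) p)%N%:R.
  rewrite big_seq_cond [in RHS]big_seq_cond.
  suff [] : \sum_(p <- P | (p \in P) && (p %| m)%N) ln (p%:R : R) =
    ln (\prod_(p <- P | (p \in P) && (p %| m)) p)%N%:R /\
    (0 < \prod_(p <- P | (p \in P) && (p %| m)) p)%N by [].
  apply: (big_rec2 (fun (x : R) (z : nat) => x = ln z%:R /\ (0 < z)%N)).
    by rewrite ln1.
  move=> p z x /andP[pP _] [-> z0]; have p0 := prime_gt0 (Pp _ pP).
  by rewrite natrM lnM ?posrE ?ltr0n// muln_gt0 p0 z0.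
have dv := dvdn_prod_primes m uP Pp.
by rewrite ler_ln ?posrE ?ltr0n ?ler_nat ?(dvdn_leq m0 dv)// (dvdn_gt0 m0 dv).
Qed.

Lemma max_pdiv_le m y : 1 <= y -> (0 < m)%N ->
  ((max_pdiv m)%:R <= y) <-> (forall q, prime q -> (q %| m)%N -> q%:R <= y).
Proof.
move=> y1 m0; split=> [h q pq qm|h].
  apply: le_trans h; rewrite ler_nat; apply: max_pdiv_max.
  by rewrite mem_primes pq m0 qm.
have [m1|] := leqP m 1; last by move=> m1; apply: h;
  rewrite ?max_pdiv_prime ?max_pdiv_dvd.
by have -> : m = 1%N by apply/eqP; rewrite eqn_leq m1 m0.
Qed.

Section friable_detection.
Variables (P : seq nat) (y v : R).
Hypotheses (uP : uniq P) (Pp : {in P, forall p, prime p}).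
Hypotheses (y1 : 1 < y) (Py : {in P, forall p, p%:R <= y}).
Let t p : R := ln p%:R / ln y.

Let lny0 : 0 < ln y. Proof. exact: ln_gt0. Qed.

Let t_ge0 p : p \in P -> 0 <= t p.
Proof.
move=> pP; rewrite divr_ge0 ?(ltW lny0)// ln_ge0// ler1n.
exact/prime_gt0/Pp.
Qed.

(* A removal contributes only when it stops at a cofactor below [y], so [n %/ d]
   is then friable; and since the [t p] with [p %| n %/ d] add up to at most
   [s], the total weight of the removals does not exceed 1. *)
Lemma peel_dvd_le K n d s E : (0 < n)%N -> (d %| n)%N -> 1 <= s ->
  ln (n %/ d)%:R <= s * ln y ->
  peel P t v (fun e => (e %| n)%:R) K d s E <= ((max_pdiv (n %/ d))%:R <=
    y)%R%:R.
Proof.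
move=> n0; elim: K d s E => [|K IH] d s E dn s1 ns /=; first by case: (_ <= y).
have d0 : (0 < d)%N by exact: dvdn_gt0 dn.
set m := (n %/ d)%N in ns *.
have m0 : (0 < m)%N by rewrite divn_gt0// dvdn_leq.
have nE : n = (d * m)%N by rewrite mulnC divnK.
set b : R := (_ <= y)%R%:R.
have b0 : 0 <= b by rewrite /b; case: (_ <= y).
rewrite ler_pdivrMl; last lra.
apply: (@le_trans _ _ (\sum_(p <- P | (p %| m)%N) t p * b)); last first.
  rewrite -mulr_suml ler_wpM2r// -mulr_suml ler_pdivrMr//.
  exact: le_trans (sum_ln_primes_le uP Pp m0) ns.
rewrite big_mkcond [leRHS]big_mkcond big_seq [leRHS]big_seq.
apply: ler_sum => p pP; have t0 := t_ge0 pP; have pp := Pp pP.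
have p0 := prime_gt0 pp.
(* If [p] does not divide [m], no multiple of [d * p] divides [n]: this removal and all that follow
   it contribute 0. *)
have [pm|pm] := boolP (p %| m)%N; last first.
  rewrite (_ : (if _ then _ else _) = 0)//.
  have dpn e : (d * p * e %| n)%N = false.
    apply/negP => h; move/negP: pm; apply; move: h.
    by rewrite nE -mulnA dvdn_pmul2l//; apply: dvdn_trans; exact: dvdn_mulr.
  have := dpn 1%N; rewrite muln1 => ->.
  case: ifP => // _; rewrite peel_eq0 => [|e]; last by rewrite dpn.
  by case: ifP => _; rewrite ?if_same mulr0.
have dpn : (d * p %| n)%N by rewrite nE dvdn_pmul2l.
have npE : (n %/ (d * p))%N = (m %/ p)%N by rewrite divnMA.
have m'0 : (0 < m %/ p)%N by rewrite divn_gt0// dvdn_leq.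
have lnm : ln (m %/ p)%N%:R = ln m%:R - ln p%:R :> R.
  have -> : m%:R = (m %/ p)%N%:R * p%:R :> R by rewrite -natrM divnK.
  by rewrite lnM ?posrE ?ltr0n// addrK.
have tp : ln p%:R = t p * ln y by rewrite /t divfK// gt_eqF.
have mp : ln (m %/ p)%N%:R <= (s - t p) * ln y by rewrite lnm tp mulrBl lerD2r.
(* Putting back a prime that is at most [y] preserves friability. *)
have fr : (max_pdiv (m %/ p)%N)%:R <= y -> (max_pdiv m)%:R <= y.
  move=> /(max_pdiv_le (ltW y1) m'0) h; apply/(max_pdiv_le (ltW y1) m0) => q pq.
  rewrite -[in (q %| m)%N](divnK pm) Euclid_dvdM// => /orP[|]; first exact: h.
  by rewrite dvdn_prime2// => /eqP ->; exact: Py.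
case: ifP => _; last exact: mulr_ge0.
apply: (ler_wpM2l t0); case: ifP => [/andP[h1 _]|_].
  rewrite dpn /b fr// (max_pdiv_le (ltW y1) m'0) => q pq qm.
  apply: (@le_trans _ _ (m %/ p)%N%:R); first by rewrite ler_nat dvdn_leq.
  have y0 : 0 < y by exact: lt_trans y1.
  rewrite -ler_ln ?posrE ?ltr0n//.
  apply: (le_trans mp); rewrite -[leRHS]mul1r ler_wpM2r ?(ltW lny0)//; lra.
case: ifP => // h.
apply: le_trans (IH _ _ _ dpn _ _) _; first lra.
  by rewrite npE.
rewrite npE /b; case: (leP (max_pdiv (m %/ p)%N)%:R y) => // /fr ->.
exact: lexx.
Qed.

End friable_detection.

(** The invariant [d <= y ^ (u - s)], together with [t p < s - v] at a stop, shows that only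
    integers up to [y ^ (u - v)] are ever evaluated. *)
Lemma le_peel P t a b v y K d s E u :
  1 < y -> {in P, forall p, (0 < p)%N /\ t p = ln p%:R / ln y} ->
  {in P, forall p, 0 <= t p} ->
  (forall e, (0 < e)%N -> e%:R <= y `^ (u - v) -> a e <= b e) ->
  1 <= s -> (0 < d)%N -> d%:R <= y `^ (u - s) ->
  peel P t v a K d s E <= peel P t v b K d s E.
Proof.
move=> y1 Pt t0 ab; have y0 : 0 < y by lra.
elim: K d s E => [//|K IH] d s E s1 d0 dy /=.
rewrite ler_wpM2l ?invr_ge0//; first lra.
rewrite big_seq_cond [leRHS]big_seq_cond; apply: ler_sum => p /andP[pP _].
have [p0 tp] := Pt _ pP.
have py : p%:R = y `^ (t p).
  rewrite /powR gt_eqF// tp -mulrA mulVf ?mulr1 ?lnK ?posrE ?ltr0n//.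
  by rewrite gt_eqF// ln_gt0.
have dp : (d * p)%:R <= y `^ (u - (s - t p)).
  rewrite (_ : u - _ = (u - s) + t p); last by ring.
  rewrite powRD ?(gt_eqF y0) ?implybT// natrM {1}py.
  by apply: ler_wpM2r => //; exact: powR_ge0.
apply: ler_wpM2l; first exact: t0.
case: ifP => [/andP[h1 h2]|_].
  apply: ab; first by rewrite muln_gt0 d0.
  apply: (le_trans dp); apply: ler_powR; first exact: ltW.
  lra.
by case: ifP => // h; apply: IH => //; [lra|rewrite muln_gt0 d0].
Qed.

End prime_peeling.

(** * The sieve inequality *)

Section sieve_lower_bound.
Variable R : realType.
Implicit Types (P E : seq nat) (u v y : R) (S : {fset nat}).

Lemma card_fset_sum S (Q : pred nat) :
  #|` [fset n in S | Q n]%fset|%:R = \sum_(n <- S) (Q n)%:R :> R.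
Proof.
rewrite -natr_sum -big_mkcond sum1_count -size_filter; congr (_%:R).
apply: perm_size; apply: uniq_perm; rewrite ?filter_uniq ?fset_uniq//.
by move=> n; rewrite !inE mem_filter andbC.
Qed.

(** Up to the sieving level A_d is at least X gamma(d) / d - |r_d|. Removal is monotone and linear
    in this function, so it produces the main term minus each |r_d| times a total weight that is at
    most 1. *)
Lemma sieve_lower_bound P u v y X S (gamma : nat -> R) K :
  uniq P -> {in P, forall p, prime p} -> {in P, forall p, p%:R <= y} -> 1 < y ->
  0 <= v -> v < 1 -> 1 <= u ->
  (forall n, n \in S -> (0 < n)%N /\ n%:R <= y `^ u) ->
  multiplicative_arith gamma ->
  X * main_term P (fun p => ln p%:R / ln y) v
      (fun p => ln p%:R / ln y * (gamma p / p%:R)) K u [::] -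
  \sum_(1 <= d < (Num.truncn (y `^ (u - v))).+1) `|remainder S X gamma d|
  <= #|` friables S y|%:R.
Proof.
move=> uP Pp Py y1 v0 v1 u1 Sn gM.
have lny0 : 0 < ln y by exact: ln_gt0.
have y0 : 0 < y by lra.
set t := fun p : nat => ln p%:R / ln y.
have Pt : {in P, forall p, (0 < p)%N /\ t p = ln p%:R / ln y}.
  by move=> p /Pp /prime_gt0.
have t0 : {in P, forall p, 0 <= t p}.
  move=> p pP; rewrite divr_ge0 ?(ltW lny0)// ln_ge0// ler1n.
  exact/prime_gt0/Pp.
have pd n d s E := @peel_dvd_le _ P y v uP Pp y1 Py K n d s E.
set D := y `^ (u - v).
pose A (e : nat) : R := #|` multiples S e|%:R.
(* The remainder is written as a combination of indicators of single integers, so that linearity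
   isolates the weight given to each [d]. *)
pose b (e : nat) : R := X * (gamma e / e%:R) + (-1) *
  \sum_(d <- index_iota 1 (Num.truncn D).+1) `|remainder S X gamma d| * (d == e)%:R.
have AE e : A e = \sum_(n <- S) 1 * (e %| n)%:R.
  by rewrite /A /multiples card_fset_sum; apply: eq_bigr => n _; rewrite mul1r.
have d1 : (1%:R : R) <= y `^ (u - u) by rewrite subrr powRr0.
apply: (@le_trans _ _ (peel P t v b K 1 u [::])).
  rewrite peelD peel_multiplicative//; last by move=> p pP _; rewrite coprime1n.
  have [-> _] := gM; rewrite divr1 mul1r lerD2l mulN1r lerN2 peel_sum.
  rewrite big_seq [leRHS]big_seq; apply: ler_sum => d.
  rewrite mem_index_iota ltnS => /andP[dd0 dD]; rewrite -[leRHS]mulr1.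
  apply: ler_wpM2l => //.
  (* Equality with [d] is weakened to divisibility of [d]: the friability bound for the integer [d]
     itself then bounds its weight by 1. *)
  apply: (@le_trans _ _ (peel P t v (fun e => (e %| d)%:R) K 1 u [::])).
    apply: (@le_peel _ _ _ _ _ _ y _ _ _ _ u) => // e e0 _.
    by case: eqP => [->|_]; rewrite ?dvdnn// ler0n.
  apply: le_trans (pd _ _ _ _ _ _ u1 _) _ => //; last first.
    by case: (_ <= y).
  rewrite divn1 -ln_powR ler_ln ?posrE ?ltr0n ?powR_gt0//.
  apply: (@le_trans _ _ D); last by apply: ler_powR; lra.
  have : (Num.truncn D)%:R <= D by rewrite truncn_le powR_ge0.
  by apply: le_trans; rewrite ler_nat.
apply: (@le_trans _ _ (peel P t v A K 1 u [::])).
  apply: (@le_peel _ _ _ _ _ _ y _ _ _ _ u) => // e e0 eD.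
  rewrite /b mulN1r.
  rewrite (bigD1_seq e) ?iota_uniq//=; last first.
    by rewrite mem_index_iota e0 ltnS truncn_ge_nat// powR_ge0.
  rewrite eqxx mulr1 big1 ?addr0; last by move=> i /negPf ->; rewrite mulr0.
  have : gamma e / e%:R * X - A e <= `|remainder S X gamma e|.
    by rewrite /remainder -normrN opprB ler_norm.
  by lra.
rewrite (_ : A = fun e => \sum_(n <- S) 1 * (e %| n)%:R); last by apply/funext.
rewrite peel_sum /friables card_fset_sum big_seq [leRHS]big_seq.
apply: ler_sum => n /Sn[n0 ny]; rewrite mul1r.
apply: le_trans (pd _ _ _ _ _ _ u1 _) _ => //; last by rewrite divn1.
by rewrite divn1 -ln_powR ler_ln ?posrE ?ltr0n ?powR_gt0.
Qed.

End sieve_lower_bound.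

(** * Comparison of the main term with the delay equation *)

Section riemann_sums.
Variable R : realType.
Notation mu := (@lebesgue_measure R).
Implicit Types (P E : seq nat) (t w : nat -> R) (kappa eta L M h : R).

Definition mass P t w (a b : R) := \sum_(p <- P | a < t p < b) w p.

(** One-sided, since only a lower bound of the main term is sought. *)
Definition approximates P t w kappa eta h := forall a b,
  0 <= a -> a <= b -> b <= h -> kappa * (b - a) - eta <= mass P t w a b.

Section with_weights.
Variables (P : seq nat) (t w : nat -> R) (kappa eta h : R).
Hypotheses (w0 : {in P, forall p, 0 <= w p}) (k0 : 0 <= kappa) (e0 : 0 <= eta).
Hypothesis Pw : approximates P t w kappa eta h.

(** On the cell [g] stays within [L * d] of [g a]. Replacing it by [m = g a - L * d] costs
    [2 * kappa * L * d ^+ 2], and the error in the mass costs at most [M * eta]. *)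
Lemma riemann_cell (g : R -> R) L M a b :
  (forall x, 0 <= g x <= M) -> lip L g -> 0 <= a -> a <= b -> b <= h ->
  kappa * \int[mu]_(x in `[a, b]) g x - (2 * kappa * L * (b - a) ^+ 2 + M * eta)
  <= \sum_(p <- P | a < t p < b) w p * g (t p).
Proof.
move=> gM gL a0 ab bh.
have cg := lip_continuous gL.
have L0 := lip_ge0 gL.
have M0 : 0 <= M by have /andP[h1 h2] := gM 0; exact: le_trans h2.
set d := b - a; have d0 : 0 <= d by rewrite /d; lra.
have near_a x : a <= x <= b -> `|g x - g a| <= L * d.
  move=> /andP[ax xb]; apply: le_trans (gL _ _) _.
  rewrite ger0_norm; last lra.
  by apply: ler_wpM2l => //; rewrite /d; lra.
have Iub : \int[mu]_(x in `[a, b]) g x <= (g a + L * d) * d.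
  apply: Rintegral_itvcc_le => // x /near_a; rewrite ler_norml => /andP[_]; lra.
set m := g a - L * d.
have S0 : 0 <= \sum_(p <- P | a < t p < b) w p * g (t p).
  rewrite big_seq_cond; apply: sumr_ge0 => p /andP[pP _].
  by apply: mulr_ge0; [exact: w0|have /andP[] := gM (t p)].
have E1 : kappa * \int[mu]_(x in `[a, b]) g x <=
    m * (kappa * d) + 2 * kappa * L * d ^+ 2.
  apply: le_trans (ler_wpM2l k0 Iub) _.
  by rewrite le_eqVlt; apply/orP; left; apply/eqP; rewrite /m; ring.
have kd0 : 0 <= kappa * d by exact: mulr_ge0.
have Me0 : 0 <= M * eta by exact: mulr_ge0.
(* If [m <= 0] the claimed lower bound is at most 0 and the sum is nonnegative. *)
have [m0|m0] := leP m 0.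
  apply: le_trans S0; have : m * (kappa * d) <= 0 by exact: mulr_le0_ge0.
  by lra.
apply: (@le_trans _ _ (m * mass P t w a b)); last first.
  rewrite /mass mulr_sumr big_seq_cond [leRHS]big_seq_cond.
  apply: ler_sum => p /andP[pP /andP[ap pb]].
  rewrite mulrC; apply: ler_wpM2l; first exact: w0.
  have : a <= t p <= b by rewrite !ltW.
  by move=> /near_a; rewrite ler_norml /m => /andP[]; lra.
apply: le_trans (ler_wpM2l (ltW m0) (Pw a0 ab bh)).
rewrite -/d mulrBr.
have mM : m * eta <= M * eta.
  apply: ler_wpM2r => //; rewrite /m; have /andP[_] := gM a.
  by have Ld : 0 <= L * d := mulr_ge0 L0 d0; lra.
by lra.
Qed.

(** With [N] equal cells the oscillation errors add up to at most [2 * kappa * L / N], since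
    [b <= 1], and the mass errors to [N * M * eta]. The number [N] will be fixed before [eta]. *)
Lemma riemann_sum (g : R -> R) L M N b : (0 < N)%N ->
  (forall x, 0 <= g x <= M) -> lip L g -> 0 <= b -> b <= h -> b <= 1 ->
  kappa * \int[mu]_(x in `[0,
    b]) g x - (2 * kappa * L / N%:R + N%:R * (M * eta))
  <= \sum_(p <- P | 0 < t p < b) w p * g (t p).
Proof.
move=> N0 gM gL b0 bh b1.
have cg := lip_continuous gL.
have L0 := lip_ge0 gL.
have N0' : 0 < N%:R :> R by rewrite ltr0n.
set d := b / N%:R; have d0 : 0 <= d by exact: divr_ge0.
have g0 x : 0 <= g x by have /andP[] := gM x.
have dN : N%:R * d = b by rewrite /d mulrC divfK// gt_eqF.
have main n : (n <= N)%N -> kappa * \int[mu]_(x in `[0, n%:R * d]) g x -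
    n%:R * (2 * kappa * L * d ^+ 2 + M * eta) <=
    \sum_(p <- P | 0 < t p < n%:R * d) w p * g (t p).
  elim: n => [_|n IH nN].
    rewrite !mul0r subr0 set_itv1 Rintegral_set1 mulr0.
    rewrite big_seq_cond; apply: sumr_ge0 => p /andP[pP _].
    by apply: mulr_ge0; [exact: w0|].
  have nd0 : 0 <= n%:R * d by exact: mulr_ge0.
  have nd1 : n%:R * d <= n.+1%:R * d by rewrite ler_wpM2r// ler_nat.
  have nd2 : n.+1%:R * d <= b by rewrite -dN ler_wpM2r// ler_nat.
  have c := riemann_cell gM gL nd0 nd1 (le_trans nd2 bh).
  have {}IH := IH (ltnW nN).
  rewrite (@Rintegral_itvcc_cat _ _ 0 (n.+1%:R * d) (n%:R * d))// mulrDr.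
  have dE : n.+1%:R * d - n%:R * d = d by rewrite -natr1; ring.
  rewrite dE in c.
  have eE : n.+1%:R * (2 * kappa * L * d ^+ 2 + M * eta) =
      n%:R * (2 * kappa * L * d ^+ 2 + M * eta) + (2 * kappa * L * d ^+ 2 + M * eta).
    by rewrite -natr1 mulrDl mul1r.
  rewrite eE.
  apply: (@le_trans _ _ (\sum_(p <- P | 0 < t p < n%:R * d) w p * g (t p) +
     \sum_(p <- P | n%:R * d < t p < n.+1%:R * d) w p * g (t p))); first lra.
  rewrite big_mkcond [X in _ + X]big_mkcond [leRHS]big_mkcond -big_split/=.
  rewrite big_seq [leRHS]big_seq; apply: ler_sum => p pP.
  have wg : 0 <= w p * g (t p) by apply: mulr_ge0; [exact: w0|].
  (* A prime sitting exactly at a division point lies in no cell; leaving it out only lowers the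
     sum. *)
  have [h1|h1] := ltP (t p) (n%:R * d).
    rewrite (ltNge (n%:R * d)) (ltW h1) /= addr0 andbT.
    by rewrite (lt_le_trans h1 nd1) andbT.
  rewrite andbF add0r; case: ifP => [/andP[h2 h3]|_].
    by rewrite h3 (le_lt_trans nd0 h2).
  by case: ifP.
have := main N (leqnn N); rewrite dN; apply: le_trans.
rewrite lerD2l lerN2 mulrDr lerD2r.
rewrite (_ : N%:R * _ = 2 * kappa * L * (b ^+ 2) / N%:R); last first.
  by rewrite /d; field; rewrite gt_eqF.
rewrite ler_wpM2r ?invr_ge0 ?(ltW N0')//.
rewrite -[leRHS]mulr1 ler_wpM2l ?mulr_ge0//.
by rewrite expr2 -[leRHS]mulr1 ler_pM.
Qed.

End with_weights.

(** The price for keeping the removed primes distinct: each excluded prime costs at most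
    [eta * M]. *)
Lemma sum_notin_ge P E t w (F : nat -> R) M eta : uniq P -> 0 <= eta ->
  {in P, forall p, 0 <= w p <= eta} -> 0 <= M -> (forall p, F p <= M) ->
  \sum_(p <- P) w p * F p - (size E)%:R * (eta * M) <=
  \sum_(p <- P | p \notin E) w p * F p.
Proof.
move=> uP e0 wP M0 FM; rewrite lerBlDr (bigID (fun p => p \notin E))/= lerD2l.
under eq_bigl do rewrite negbK.
rewrite -big_filter.
apply: (@le_trans _ _ (\sum_(p <- [seq p <- P | p \in E]) eta * M)).
  rewrite big_seq [leRHS]big_seq; apply: ler_sum => p.
  rewrite mem_filter => /andP[_ /wP/andP[w1 w2]].
  apply: (@le_trans _ _ (w p * M)); first exact: ler_wpM2l.
  exact: ler_wpM2r.
rewrite big_const_seq count_predT iter_addr_0 -[leLHS]mulr_natl.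
rewrite ler_wpM2r ?mulr_ge0// ler_nat uniq_leq_size ?filter_uniq//.
by move=> p; rewrite mem_filter => /andP[].
Qed.

(** The main term obeys the delay equation with a sum over primes in place of the integral. The
    induction on [K] treats all [J] at once because each removal lengthens [E]; [eta] depends on
    neither [u] nor [v]. *)
Lemma main_term_lower kappa K : 0 < kappa ->
  forall (J : nat) (eps : R), 0 < eps ->
  exists2 eta : R, 0 < eta &
  forall P t w v u, uniq P -> 0 <= v -> v < 1 ->
    {in P, forall p, 0 < t p < 1} -> {in P, forall p, 0 <= w p <= eta} ->
    approximates P t w kappa eta (Num.min 1 (u - v)) ->
  forall s E, 1 <= s -> s <= u -> (size E <= J)%N ->
    mu_partial kappa v K s - eps <= main_term P t v w K s E.
Proof.
move=> k0; have k0' := ltW k0; elim: K => [|K IH] J eps eps0.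
  exists 1 => // *; rewrite /mu_partial big_nil /= sub0r; lra.
have [M [L ML]] := mu_partial_bounded_lip K k0'.
have M0 : 0 <= M by have [h _] := ML 0; apply: le_trans (h 0).
have L0 : 0 <= L by have [_ h] := ML 0; exact: lip_ge0 h.
set eps' := eps / (4 * kappa).
have eps'0 : 0 < eps' by rewrite divr_gt0// mulr_gt0.
have [eta1 eta10 {}IH] := IH J.+1 eps' eps'0.
pose N := (Num.truncn (8 * kappa * L / eps)).+1.
have NL : 2 * kappa * L / N%:R <= eps / 4.
  have : 8 * kappa * L / eps < N%:R by exact: truncnS_gt.
  rewrite ltr_pdivrMr// => h; rewrite ler_pdivrMr ?ltr0n//; lra.
(* [Q] collects the coefficients of [eta]: 1 from the window, [N * M] from the cells, [J * (1 + M)]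
   from the excluded primes. *)
pose Q : R := 1 + N%:R * M + J%:R * (1 + M).
have NM0 : 0 <= N%:R * M by exact: mulr_ge0.
have JM0 : 0 <= J%:R * (1 + M) by apply: mulr_ge0 => //; lra.
have Q0 : 0 < Q by rewrite /Q; lra.
pose eta := Num.min eta1 (eps / (4 * Q)).
have eta0 : 0 < eta by rewrite lt_min eta10 divr_gt0// mulr_gt0.
have etaQ : eta * Q <= eps / 4.
  apply: (@le_trans _ _ (eps / (4 * Q) * Q)).
    by rewrite ler_wpM2r ?(ltW Q0)// ge_min lexx orbT.
  by rewrite le_eqVlt; apply/orP; left; apply/eqP; field; rewrite gt_eqF.
exists eta => // P t w v u uP v0 v1 tP wP Pw s E s1 su sE.
have [pM pL] := ML v; set phi := mu_partial kappa v K in pM pL.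
have w0 : {in P, forall p, 0 <= w p} by move=> p /wP /andP[].
have wP1 : {in P, forall p, 0 <= w p <= eta1}.
  by move=> p /wP /andP[-> /le_trans]; apply; rewrite ge_min lexx.
have Pw1 : approximates P t w kappa eta1 (Num.min 1 (u - v)).
  move=> a b a0 ab bh; apply: le_trans (Pw a b a0 ab bh).
  by rewrite lerD2l lerN2 ge_min lexx.
have {}IH := IH P t w v u uP v0 v1 tP wP1 Pw1.
(* Truncating at 0 gives the nonnegative function required for the Riemann sum and still bounds the
   main term from below, as that term is nonnegative. *)
pose g x := Num.max 0 (phi (s - x) - eps').
have gM x : 0 <= g x <= M.
  rewrite /g le_max lexx/= ge_max M0/=.
  by have := pM (s - x); rewrite ler_norml => /andP[_]; lra.
have gL : lip L g.
  move=> x y; apply: le_trans (lip_comp_sub s pL x y); rewrite /g.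
  set a := phi _; set b := phi _.
  have [ab|ab] := leP (a - eps') (b - eps').
    have /andP[h1 h2] := max_incr 0 ab.
    by rewrite distrC ger0_norm// distrC ger0_norm; lra.
  have /andP[h1 h2] := max_incr 0 (ltW ab).
  by rewrite ger0_norm// ger0_norm; lra.
have h0 := horizon_ge0 s; have h1 := horizon_le1 s; have h2 := horizon_le s.
rewrite clamp_id// in h2.
have hu : horizon s <= Num.min 1 (u - v) by rewrite le_min h1/=; lra.
pose F p : R := if s - 1 < t p < s - v then 1 else if t p < s - 1 then g (t p) else 0.
have FM p : F p <= 1 + M.
  have /andP[? ?] := gM (t p).
  by rewrite /F; case: ifP => _; [|case: ifP => _]; lra.
have lamF : s^-1 * \sum_(p <- P | p \notin E) w p * F p <=
  main_term P t v w K.+1 s E.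
  rewrite /= ler_wpM2l ?invr_ge0//; first lra.
  rewrite big_seq_cond [leRHS]big_seq_cond; apply: ler_sum => p /andP[pP _].
  apply: ler_wpM2l; first exact: w0.
  rewrite /F; case: ifP => // _; case: ifP => // ps.
  have st : 1 <= s - t p by lra.
  rewrite /g ge_max main_term_ge0//=; apply: IH => //.
  by have /andP[? _] := tP _ pP; lra.
have sumE := @sum_notin_ge P E t w F (1 + M) eta uP (ltW eta0) wP _ FM.
have {}sumE := sumE (addr_ge0 ler01 M0).
have hsize : (size E)%:R * (eta * (1 + M)) <= eta * (J%:R * (1 + M)).
  rewrite mulrCA; apply: ler_wpM2l; first exact: ltW.
  by apply: ler_wpM2r; [lra|rewrite ler_nat].
(* The removals that stop correspond to the window, those that continue to the delay integral. *)
have split : \sum_(p <- P) w p * F p =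
    mass P t w (s - 1) (Num.min 1 (s - v)) +
    \sum_(p <- P | 0 < t p < horizon s) w p * g (t p).
  rewrite /mass [X in _ = X + _]big_mkcond [X in _ =
    _ + X]big_mkcond -big_split/=.
  rewrite big_seq [RHS]big_seq; apply: eq_bigr => p pP.
  have /andP[t0 t1] := tP _ pP.
  rewrite /F /horizon clamp_id// !lt_min t0 t1 /=.
  case: ifP => [/andP[a1 a2]|_]; first by rewrite ltNge (ltW a1) /= mulr1 addr0.
  by rewrite add0r; case: ifP; rewrite ?mulr0.
have hwindow : kappa * window v s - eta <=
  mass P t w (s - 1) (Num.min 1 (s - v)).
  have hE : Num.min (2 - s) (1 - v) = Num.min 1 (s - v) - (s - 1).
    rewrite !minEle; have [?|?] := leP 1 (s - v);
    by have [?|?] := leP (2 - s) (1 - v); lra.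
  rewrite /window clamp_id// hE.
  have [hle|hgt] := leP (s - 1) (Num.min 1 (s - v)); last first.
    rewrite max_l; last lra.
    rewrite mulr0 sub0r; apply: (@le_trans _ _ 0); first lra.
    by rewrite /mass big_seq_cond; apply: sumr_ge0 => p /andP[/w0].
  rewrite max_r; last lra.
  apply: Pw => //; first lra.
  by rewrite le_min !ge_min lexx /=; apply/orP; right; lra.
have htail := riemann_sum w0 k0' (ltW eta0) Pw (ltn0Sn _) gM gL h0 hu h1.
have {}htail := htail (Num.truncn (8 * kappa * L / eps)).
rewrite -/N in htail.
have cg := lip_continuous gL.
have cphi := @continuous_comp_sub _ _ s (lip_continuous pL).
have hint : delay phi s - eps' <= \int[mu]_(x in `[0, horizon s]) g x.
  apply: (@le_trans _ _ (\int[mu]_(x in `[0, horizon s]) (phi (s - x) - eps'))).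
    rewrite Rintegral_itvccB//; last by move=> x; exact: cvg_cst.
    rewrite Rintegral_itvcc_cst// subr0 /delay clamp_id// lerD2l lerN2.
    by rewrite -[leRHS]mulr1 ler_wpM2l// ltW.
  apply: le_Rintegral_itvcc => //.
    by move=> x; apply: cvgB; [exact: cphi|exact: cvg_cst].
  by move=> x _; rewrite /g le_max lexx orbT.
have kint := ler_wpM2l k0' hint; rewrite mulrBr in kint.
have keps : kappa * eps' = eps / 4 by rewrite /eps'; field; rewrite gt_eqF.
apply: le_trans lamF.
rewrite mu_partialS// clamp_id// -/phi mulrCA.
have [s0 si] : 0 < s^-1 /\ s^-1 <= 1.
  by split; [rewrite invr_gt0; lra|rewrite invf_le1//; lra].
rewrite lerBlDr; apply: (@le_trans _ _ (s^-1 *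
   (\sum_(p <- P | p \notin E) w p * F p + eps))).
  rewrite ler_wpM2l ?(ltW s0)// mulrDr.
  have etaQE : eta * Q = eta + N%:R * (M * eta) + eta * (J%:R * (1 + M)).
    by rewrite /Q; ring.
  by move: sumE; rewrite split; lra.
by rewrite mulrDr lerD2l -[leRHS]mul1r ler_wpM2r// ltW.
Qed.

End riemann_sums.

(** * Distribution of the weighted primes *)

Section mertens.
Variable R : realType.
Implicit Types (gamma f : nat -> R) (a b y z A B kappa : R).

Lemma sum_unique_le (r : seq nat) (Q : pred nat) f B : uniq r -> 0 <= B ->
  (forall p q, Q p -> Q q -> p = q) -> (forall p, Q p -> f p <= B) ->
  \sum_(p <- r | Q p) f p <= B.
Proof.
move=> ur B0 Q1 fB; have [/hasP[p pr Qp]|/hasPn nQ] := boolP (has Q r).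
  rewrite -big_filter (bigD1_seq p) ?filter_uniq ?mem_filter ?Qp//=.
  rewrite big_seq_cond big1 ?addr0 ?fB// => q /andP[+ qp].
  by rewrite mem_filter => /andP[/Q1/(_ Qp) qE]; rewrite qE eqxx in qp.
by rewrite big_seq_cond big1// => p /andP[/nQ/negPf ->].
Qed.

Definition prime_sum gamma z : R :=
  \sum_(0 <= p < (Num.truncn z).+1 | prime p) ln p%:R / p%:R * gamma p.

(** Puts prime sums with different bounds over one index range, so that they can be subtracted. *)
Lemma prime_sum_iota gamma z n : 0 <= z -> z < n%:R ->
  prime_sum gamma z = \sum_(p <- index_iota 0 n | prime p && (p%:R <= z))
    ln p%:R / p%:R * gamma p.
Proof.
move=> z0 zn; rewrite /prime_sum.
have tn : ((Num.truncn z).+1 <= n)%N by rewrite -truncn_lt_nat// in zn.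
rewrite [in RHS](@big_cat_nat _ _ _ (Num.truncn z).+1)//=.
rewrite [X in _ = _ + X]big1_seq ?addr0.
  rewrite big_nat_cond [RHS]big_nat_cond; apply: eq_bigl => p.
  have [/andP[_ pz]|//] := boolP (0 <= p < _)%N.
  by rewrite -(@truncn_ge_nat _ z p z0) -ltnS pz andbT.
move=> p /andP[/andP[_ pz]]; rewrite mem_index_iota => /andP[h _].
by move: h; rewrite ltnNge truncn_ge_nat// pz.
Qed.

(* Dropping the primes with [gamma p < 0] makes all weights nonnegative and can
   only increase the weighted prime sums, which are bounded from below. *)
Definition sieving_primes gamma y : seq nat :=
  [seq p <- index_iota 0 (Num.truncn y).+1 |
    [&& prime p, p%:R < y & 0 <= gamma p]].

Section density.
Variables (gamma : nat -> R) (kappa A B y : R).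
Hypotheses (k0 : 0 <= kappa) (A0 : 0 <= A) (B0 : 0 <= B) (y1 : 1 < y).
Hypothesis mertens : forall z, 2 <= z ->
  `|prime_sum gamma z - kappa * ln z| <= A.
Hypothesis gammaB : forall p, prime p -> gamma p <= B.
Let t p : R := ln p%:R / ln y.
Let w p : R := t p * (gamma p / p%:R).

Let lny0 : 0 < ln y. Proof. exact: ln_gt0. Qed.
Let y0 : 0 < y. Proof. exact: lt_trans y1. Qed.

Let f (p : nat) : R := ln p%:R / p%:R * gamma p.

Let fB p : prime p -> f p <= B.
Proof.
move=> pp; have p0 := prime_gt0 pp; have p1 := prime_gt1 pp.
have l0 : 0 <= ln p%:R / p%:R :> R by rewrite divr_ge0// ln_ge0// ler1n.
have l1 : ln p%:R / p%:R <= 1 :> R.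
  rewrite ler_pdivrMr ?ltr0n// mul1r -ler_expR lnK ?posrE ?ltr0n//.
  by apply: le_trans (expR_ge1Dx _); rewrite lerDr.
apply: (@le_trans _ _ (ln p%:R / p%:R * B)); first by rewrite ler_wpM2l ?gammaB.
by rewrite -[leRHS]mul1r ler_wpM2r.
Qed.

Let wE p : w p = f p / ln y.
Proof. by rewrite /w /t /f; ring. Qed.

Let t_le p c : (0 < p)%N -> (t p <= c) = (p%:R <= y `^ c).
Proof.
move=> p0; rewrite /t ler_pdivrMr// -[RHS]ler_ln ?posrE ?ltr0n ?powR_gt0//.
by rewrite ln_powR.
Qed.

(** When [y ^ c < 2] the sum is empty and [kappa * (c * ln y)] lies between 0 and [kappa * ln 2]. *)
Lemma prime_sum_bounds c : 0 <= c ->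
  kappa * (c * ln y) - (A + kappa * ln 2) <= prime_sum gamma (y `^ c) /\
  prime_sum gamma (y `^ c) <= kappa * (c * ln y) + A.
Proof.
move=> c0; have ln20 : 0 <= ln 2 :> R by rewrite ln_ge0// ler1n.
have kl := mulr_ge0 k0 ln20.
have A0' := A0; have B0' := B0.
have [y2|y2] := leP 2 (y `^ c).
  have := mertens y2; rewrite ln_powR ler_norml => /andP[? ?].
  by split; lra.
rewrite /prime_sum big_nat_cond big1; last first.
  move=> p /andP[/andP[_ pz] pp]; move: pz.
  rewrite ltnS truncn_ge_nat ?powR_ge0// => pz.
  have := le_lt_trans pz y2; rewrite ltr_nat => p2.
  by have := prime_gt1 pp; rewrite ltnNge -ltnS p2.
have cl : 0 <= kappa * (c * ln y) by rewrite !mulr_ge0// ltW.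
have cl2 : kappa * (c * ln y) <= kappa * ln 2.
  rewrite ler_wpM2l// -ln_powR ler_ln ?posrE ?powR_gt0//; exact: ltW.
by split; lra.
Qed.

(* Each of the two prime sums costs [A], the prime possibly sitting at the right
   endpoint costs [B], and [kappa * ln 2] covers the range [z < 2] where (1) is
   not assumed. *)
Lemma sieving_primes_mass :
  approximates (sieving_primes gamma y) t w kappa
    ((2 * A + B + kappa * ln 2) / ln y) 1.
Proof.
move=> a b a0 ab b1.
have ln20 : 0 <= ln 2 :> R by rewrite ln_ge0// ler1n.
have kl := mulr_ge0 k0 ln20.
have A0' := A0; have B0' := B0.
set n := (Num.truncn y).+1.
have yn : y < n%:R by exact: truncnS_gt.
have ycn c : c <= 1 -> y `^ c < n%:R.
  move=> c1; apply: le_lt_trans yn; rewrite -[leRHS]powRr1 ?(ltW y0)//.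
  by apply: ler_powR => //; exact: ltW.
have psE c : c <= 1 -> prime_sum gamma (y `^ c) =
    \sum_(p <- index_iota 0 n | prime p && (t p <= c)) f p.
  move=> c1; rewrite (@prime_sum_iota gamma _ n) ?powR_ge0 ?ycn//.
  apply: eq_bigl => p; case pp: (prime p) => //=.
  by rewrite t_le// prime_gt0.
have drop : \sum_(p <- index_iota 0 n | prime p && (a < t p < b)) f p / ln y <=
    mass (sieving_primes gamma y) t w a b.
  rewrite /mass /sieving_primes big_filter_cond.
  rewrite big_mkcond [leRHS]big_mkcond; apply: ler_sum => p _.
  case pp: (prime p) => //=; have p0 := prime_gt0 pp.
  have [/andP[ap pb]|_] := boolP (a < t p < b); last by rewrite andbF.
  have py : p%:R < y.
    have : t p < 1 by exact: lt_le_trans b1.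
    by rewrite /t ltr_pdivrMr// mul1r ltr_ln ?posrE ?ltr0n.
  rewrite py andbT /=; have [g0|g0] := leP 0 (gamma p); first by rewrite wE.
  rewrite pmulr_lle0 ?invr_gt0// /f nmulr_lle0//.
  by rewrite divr_ge0// ln_ge0// ler1n.
apply: le_trans drop; rewrite -mulr_suml.
rewrite -(ler_pM2r lny0) divfK ?gt_eqF// mulrBl divfK ?gt_eqF//.
have [la _] := prime_sum_bounds (le_trans a0 ab).
have [_ ua] := prime_sum_bounds a0.
rewrite psE// in la; rewrite psE ?(le_trans ab)// in ua.
have tinj p q : prime p && (t p == b) -> prime q && (t q == b) -> p = q.
  move=> /andP[pp /eqP tp] /andP[pq /eqP tq]; apply/eqP; rewrite -(@eqr_nat R).
  apply/eqP; apply: (@ln_inj R); rewrite ?posrE ?ltr0n ?prime_gt0//.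
  by move: tp; rewrite -tq /t; move/mulIf; apply; rewrite invr_eq0 gt_eqF.
have atom : \sum_(p <- index_iota 0 n | prime p && (t p == b)) f p <= B.
  apply: sum_unique_le => //; first exact: iota_uniq.
  by move=> p /andP[/fB].
(* The case [a = b] is set apart: the splitting below would count a prime at the common endpoint
   twice. *)
move: ab; rewrite le_eqVlt => /predU1P[<-|ab].
  rewrite subrr mulr0 mul0r big1; first by rewrite sub0r; lra.
  by move=> p /andP[_ /andP[h1]]; rewrite ltNge (ltW h1).
have split : \sum_(p <- index_iota 0 n | prime p && (t p <= b)) f p =
    \sum_(p <- index_iota 0 n | prime p && (t p <= a)) f p +
    (\sum_(p <- index_iota 0 n | prime p && (a < t p < b)) f p +
     \sum_(p <- index_iota 0 n | prime p && (t p == b)) f p).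
  rewrite big_mkcond [X in _ = X + _]big_mkcond [X in _ =
    _ + (X + _)]big_mkcond.
  rewrite [X in _ = _ + (_ + X)]big_mkcond -!big_split/=; apply: eq_bigr => p _.
  case: (prime p) => /=; last by rewrite !addr0.
  have [h|h] := leP (t p) a.
    rewrite (le_trans h (ltW ab)) (lt_eqF (le_lt_trans h ab)).
    by rewrite /= !addr0.
  by have [h'|h'|h'] := ltgtP (t p) b; rewrite ?add0r ?addr0.
have E : kappa * (b - a) * ln y =
  kappa * (b * ln y) - kappa * (a * ln y) by ring.
by rewrite E; lra.
Qed.

Lemma sieving_primes_weight :
  {in sieving_primes gamma y, forall p, 0 <= w p <= B / ln y}.
Proof.
move=> p; rewrite mem_filter => /andP[/and3P[pp _ g0] _].
rewrite wE ler_pM2r ?invr_gt0// fB// andbT divr_ge0 ?(ltW lny0)//.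
by rewrite mulr_ge0// divr_ge0// ln_ge0// ler1n prime_gt0.
Qed.

Lemma sieving_primes_range : {in sieving_primes gamma y, forall p, 0 < t p < 1}.
Proof.
move=> p; rewrite mem_filter => /andP[/and3P[pp py _] _].
rewrite divr_gt0 ?ln_gt0 ?ltr1n ?prime_gt1//=.
by rewrite /t ltr_pdivrMr// mul1r ltr_ln ?posrE ?ltr0n ?prime_gt0.
Qed.

End density.
End mertens.

(** * Positivity, limit and lower bound for friable integers *)

Section friable_lower_bound.
Variable R : realType.
Implicit Types (theta kappa u v y X eta h : R).

Lemma approximates_weaken P (t w : nat -> R) kappa eta eta' h h' :
  eta <= eta' -> h' <= h -> approximates P t w kappa eta h ->
  approximates P t w kappa eta' h'.
Proof.
move=> ee hh H a b a0 ab bh; apply: le_trans (H a b a0 ab (le_trans bh hh)).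
by rewrite lerD2l lerN2.
Qed.

Lemma rho_tk_gt0 theta kappa u : 0 < theta -> theta < 1 -> 0 < kappa ->
  1 <= u -> (1 - theta) * u < 1 -> 0 < rho_tk theta kappa u.
Proof. by move=> ? ? ? ? ?; rewrite rho_tk_lim//;
  exact: lim_mu_partial_gt0. Qed.

Lemma rho_tk_cvg_dickman (rho : R -> R) u : is_dickman rho -> 1 <= u ->
  rho_tk theta 1 u @[theta --> 1^'-] --> rho u.
Proof.
move=> drho u1; have [M rM] := dickman_bounded u drho.
set C := 2 * u * expR (2 * (u - 1)).
have C0 : 0 <= C by rewrite !mulr_ge0 ?expR_ge0//; lra.
apply/cvgrPdist_lt => e e0.
(* The first bound ensures [(1 - theta) * u < 1], the second [(1 - theta) * C < e]. *)
pose d := Num.min (u + 1)^-1 (e / (C + 1)).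
have d0 : 0 < d.
  by rewrite lt_min invr_gt0 divr_gt0//=; [apply/andP; split=> //|]; lra.
near=> theta.
have th1 : theta < 1 by near: theta; exact: nbhs_left_lt.
have thd : 1 - d < theta by near: theta; apply: nbhs_left_gt; lra.
have thd1 : 1 - theta < (u + 1)^-1.
  by apply: (@lt_le_trans _ _ d); [lra|rewrite ge_min lexx].
have thd2 : 1 - theta < e / (C + 1).
  by apply: (@lt_le_trans _ _ d); [lra|rewrite ge_min lexx orbT].
have v1 : (1 - theta) * u < 1.
  have : (1 - theta) * (u + 1) < 1.
    by rewrite -ltr_pdivlMr ?mul1r//; lra.
  by lra.
have v0 : 0 <= (1 - theta) * u by apply: mulr_ge0; lra.
rewrite rho_tk_lim//;
  apply: le_lt_trans (lim_mu_partial_dickman drho v0 v1 rM u1) _.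
have -> : 2 * ((1 - theta) * u) * expR (2 * (u - 1)) = (1 - theta) * C.
  by rewrite /C; ring.
have : (1 - theta) * (C + 1) < e by rewrite -ltr_pdivlMr//; lra.
by lra.
Unshelve. all: by end_near. Qed.

(** The choices come in order: [K] truncates the series uniformly for [u <= U], then [eta] governs
    the main term, and finally [Lam] bounds [ln y] from below. As [ln y = ln x / u >= ln x / U],
    taking [x] at least [expR (U * Lam)] suffices. *)
Lemma friables_lower_bound theta kappa A B C delta :
  0 < theta -> theta < 1 -> 0 < kappa ->
  0 <= A -> 0 <= B -> 0 <= C -> 0 < delta ->
  forall U eps : R, 0 < eps ->
  exists x0 : R,
  forall (u y X : R) (S : {fset nat}) (gamma : nat -> R),
    1 <= u -> u <= U -> (1 - theta) * u < 1 ->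
    S != fset0 -> (forall n : nat, n \in S -> (0 < n)%N) ->
  let x : R := (\max_(n <- S) n)%N%:R in
    x0 <= x ->
    1 < y -> u = ln x / ln y ->
    0 < X -> multiplicative_arith gamma ->
    (forall z : R, 2 <= z -> `|prime_sum gamma z - kappa * ln z| <= A) ->
    (forall p a : nat, prime p -> (1 <= a)%N -> gamma (p ^ a)%N <= B) ->
    \sum_(1 <= d < (Num.truncn (y `^ (u * theta))).+1)
       `| remainder S X gamma d | <= C * (X / (ln y) `^ delta) ->
    (rho_tk theta kappa u - eps) * #|` S|%:R <= #|` friables S y|%:R.
Proof.
move=> th0 th1 k0 A0 B0 C0 delta0 U eps eps0; have k0' := ltW k0.
have [U1|U1] := ltP U 1.
  by exists 0 => u ? ? ? ? u1 uU; exfalso; lra.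
(* [M0] bounds both the coefficient of [1 / 2 ^+ K] in the tail and the whole series, for all
   [u <= U]. *)
pose M0 := 2 * kappa * expR (2 * kappa * (U - 1)).
have M00 : 0 < M0 by rewrite mulr_gt0 ?expR_gt0//; lra.
have expU u : 1 <= u -> u <= U ->
    2 * kappa * expR (2 * kappa * (clamp u - 1)) <= M0.
  move=> u1 uU; rewrite clamp_id// /M0; apply: ler_wpM2l; first lra.
  by rewrite ler_expR; apply: ler_wpM2l; lra.
pose K := (Num.truncn (M0 / (eps / 4))).+1.
have MK : M0 / 2 ^+ K <= eps / 4.
  have h : M0 / (eps / 4) < K%:R by exact: truncnS_gt.
  have h2 : K%:R <= 2 ^+ K :> R by rewrite -natrX ler_nat ltnW// ltn_expl.
  have e4 : 0 < eps / 4 by lra.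
  rewrite ler_pdivrMr ?exprn_gt0//.
  move: h; rewrite ltr_pdivrMr// => h.
  by apply: (le_trans (ltW h)); rewrite mulrC ler_wpM2l// ltW.
have e40 : 0 < eps / 4 by lra.
have [eta eta0 lamL] := main_term_lower K k0 0 e40.
(* Chosen so that the remainders and the passage from X to the cardinality of A together cost at
   most [eps / 4]. *)
pose tau0 := eps / (4 * (1 + M0)).
have tau00 : 0 < tau0 by rewrite divr_gt0//; lra.
pose c1 := 2 * A + B + kappa * ln 2.
have ln20 : 0 <= ln 2 :> R by rewrite ln_ge0// ler1n.
have c10 : 0 <= c1 by rewrite /c1; have := mulr_ge0 k0' ln20; lra.
(* Once [ln y >= Lam], the mass error [c1 / ln y] is at most [eta] and the relative remainder is at
   most [tau0]. *)
pose Lam := Num.max 1 (Num.max (c1 / eta) ((C / tau0) `^ delta^-1)).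
have Lam1 : 1 <= Lam by rewrite /Lam le_max lexx.
exists (expR (U * Lam)) =>
  u y X S gamma u1 uU v1 S0 Spos x x0x y1 uE X0 gM mert gB rem.
set v := (1 - theta) * u in v1.
have v0 : 0 <= v by rewrite /v mulr_ge0//; lra.
have lny0 : 0 < ln y by exact: ln_gt0.
have y0 : 0 < y by lra.
have xpos : 0 < x by apply: lt_le_trans x0x; exact: expR_gt0.
have lnx : ln x = u * ln y by rewrite uE divfK// gt_eqF.
have yu : y `^ u = x by rewrite /powR gt_eqF// -lnx lnK.
have LamY : Lam <= ln y.
  have h : U * Lam <= ln x by rewrite -ler_expR lnK.
  have h2 : u * ln y <= U * ln y by rewrite ler_wpM2r// ltW.
  rewrite -(@ler_pM2l _ U); last lra.
  by rewrite (le_trans h)// lnx.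
have etaY : c1 / ln y <= eta.
  rewrite ler_pdivrMr// mulrC -ler_pdivrMr//; apply: le_trans LamY.
  by rewrite /Lam !le_max lexx orbT.
pose tau := C / (ln y) `^ delta.
have tauY : tau <= tau0.
  rewrite /tau ler_pdivrMr ?powR_gt0// mulrC -ler_pdivrMr//.
  have -> : C / tau0 = ((C / tau0) `^ delta^-1) `^ delta.
    rewrite -powRrM mulVf ?gt_eqF// powRr1//.
    by apply: divr_ge0 => //; exact: ltW.
  apply: ge0_ler_powR; [exact: ltW|rewrite nnegrE powR_ge0//|by rewrite nnegrE ltW|].
  by apply: le_trans LamY; rewrite /Lam !le_max lexx !orbT.
have tau_ge0 : 0 <= tau by rewrite divr_ge0// powR_ge0.
have tauX : C * (X / (ln y) `^ delta) = tau * X by rewrite /tau; ring.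
rewrite tauX in rem.
have uth : u * theta = u - v by rewrite /v; ring.
rewrite uth in rem.
have gB1 p : prime p -> gamma p <= B by move=> pp; have := gB p 1%N pp;
  rewrite expn1; apply.
set P := sieving_primes gamma y.
pose t p : R := ln p%:R / ln y.
pose w p : R := t p * (gamma p / p%:R).
have uP : uniq P by apply: filter_uniq; exact: iota_uniq.
have Pp : {in P, forall p, prime p} by move=> p;
  rewrite mem_filter => /andP[/andP[]].
have Py : {in P, forall p, p%:R <= y}.
  by move=> p; rewrite mem_filter => /andP[/and3P[_ /ltW]].
have BY : B / ln y <= eta.
  apply: le_trans etaY; rewrite ler_wpM2r ?invr_ge0 ?(ltW lny0)// /c1.
  by have := mulr_ge0 k0' ln20; lra.
have wP : {in P, forall p, 0 <= w p <= eta}.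
  move=> p /(sieving_primes_weight B0 y1 gB1)/andP[-> h] /=.
  exact: le_trans BY.
have Pm : approximates P t w kappa eta (Num.min 1 (u - v)).
  apply: approximates_weaken (sieving_primes_mass k0' A0 B0 y1 mert gB1) => //.
  by rewrite ge_min lexx.
have tP := sieving_primes_range y1 (gamma := gamma).
have lamu := lamL P t w v u uP v0 v1 tP wP Pm u [::] u1 (lexx _) (leq0n _).
have Sn n : n \in S -> (0 < n)%N /\ n%:R <= y `^ u.
  move=> nS; split; first exact: Spos.
  by rewrite yu ler_nat; apply: leq_bigmax_seq.
have sieve := @sieve_lower_bound R P u v y X S gamma K uP Pp Py y1 v0 v1 u1 Sn gM.
have rho_le : rho_tk theta kappa u <= mu_partial kappa v K u + eps / 4.
  rewrite rho_tk_lim// -/v; apply: le_trans (lim_mu_partial_le v K u k0) _.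
  rewrite lerD2l; apply: le_trans MK.
  by rewrite mulrAC ler_wpM2r ?invr_ge0 ?exprn_ge0// expU.
have rho_M0 : rho_tk theta kappa u <= M0.
  rewrite rho_tk_lim// -/v; apply: le_trans (lim_mu_partial_le v 0 u k0) _.
  by rewrite /mu_partial big_nil add0r expr0 divr1 expU.
(* The term d = 1 of the remainder sum compares the cardinality of A with X. *)
have cardS : #|` S|%:R <= (1 + tau) * X.
  have r1 : `|remainder S X gamma 1| <= tau * X.
    apply: le_trans rem; rewrite big_ltn; last first.
      rewrite ltnS truncn_gt0 -(powRr0 y); apply: ler_powR; first exact: ltW.
      by rewrite -uth mulr_ge0//; lra.
    by rewrite lerDl sumr_ge0.
  have m1 : multiples S 1 = S.
    by apply/fsetP => n; rewrite !inE dvd1n andbT.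
  have [g1 _] := gM.
  move: r1; rewrite /remainder m1 g1 divr1 mul1r ler_norml => /andP[_].
  by rewrite mulrDl mul1r; lra.
(* If the coefficient is at most [eps] the left-hand side is not positive; otherwise [cardS] may be
   multiplied by the positive factor. *)
have [re|re] := leP (rho_tk theta kappa u) eps.
  apply: (@le_trans _ _ 0); last exact: ler0n.
  by apply: mulr_le0_ge0 => //; rewrite subr_le0.
apply: le_trans sieve; rewrite -/t -/w.
(* Half of [eps] pays for the truncation and the prime sums, [tau] for the remainders. *)
apply: (@le_trans _ _ (X * (rho_tk theta kappa u - eps / 2 - tau))); last first.
  have := ler_wpM2l (ltW X0) lamu; have := ler_wpM2l (ltW X0) rho_le.
  by rewrite -/P /P; move: rem; lra.
have Mtau : tau * (1 + M0) <= eps / 4.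
  apply: (@le_trans _ _ (tau0 * (1 + M0))); first by rewrite ler_wpM2r//; lra.
  by rewrite le_eqVlt; apply/orP; left; apply/eqP; rewrite /tau0; field; lra.
set r := rho_tk theta kappa u in re rho_le rho_M0 *.
have rtau : tau * r <= tau * M0 by exact: ler_wpM2l.
apply: (@le_trans _ _ ((r - eps) * ((1 + tau) * X))).
  by rewrite ler_wpM2l//; lra.
rewrite mulrA mulrC ler_wpM2l ?(ltW X0)//.
have := mulr_ge0 tau_ge0 (ltW eps0).
by lra.
Qed.

End friable_lower_bound.

Theorem mainTheorem1 (R : realType) :
  (* the lower bound, with o(1) as x -> +oo uniform for bounded u *)
  (forall theta kappa A B C delta : R,
     0 < theta -> theta < 1 -> 0 < kappa ->
     0 <= A -> 0 <= B -> 0 <= C -> 0 < delta ->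
   forall U eps : R, 0 < eps ->
   exists x0 : R,
   forall (u y X : R) (S : {fset nat}) (gamma : nat -> R),
     1 <= u -> u <= U -> (1 - theta) * u < 1 ->
     S != fset0 -> (forall n : nat, n \in S -> (0 < n)%N) ->
   let x : R := (\max_(n <- S) n)%N%:R in
     x0 <= x ->
     1 < y -> u = ln x / ln y ->
     0 < X -> multiplicative_arith gamma ->
     (forall z : R, 2 <= z ->
        `| \sum_(0 <= p < (Num.truncn z).+1 | prime p)
              ln (p%:R) / p%:R * gamma p - kappa * ln z | <= A) ->
     (forall p a : nat, prime p -> (1 <= a)%N -> gamma (p ^ a)%N <= B) ->
     \sum_(1 <= d < (Num.truncn (y `^ (u * theta))).+1)
        `| remainder S X gamma d | <= C * (X / (ln y) `^ delta) ->
     (rho_tk theta kappa u - eps) * #|` S|%:R <= #|` friables S y|%:R)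
  /\
  (* the coefficient is positive *)
  (forall theta kappa u : R,
     0 < theta -> theta < 1 -> 0 < kappa -> 1 <= u -> (1 - theta) * u < 1 ->
     0 < rho_tk theta kappa u)
  /\
  (* the limit theta -> 1, theta < 1, when kappa = 1 *)
  (forall rho : R -> R, is_dickman rho ->
   forall u : R, 1 <= u ->
     rho_tk theta 1 u @[theta --> 1^'-] --> rho u).
Proof.
split; last split.
- move=> theta kappa A B C delta th0 th1 k0 A0 B0 C0 delta0 U eps eps0.
  exact: (@friables_lower_bound R theta kappa A B C delta).
- by move=> theta kappa u; exact: rho_tk_gt0.
- by move=> rho drho u u1; exact: rho_tk_cvg_dickman.
Qed.
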